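(* Let $\mathcal H$ be an irreducible complete Nevanlinna-Pick space which is standard graded. If $f \in \mathcal H$ is homogeneous, then $f \in \operatorname{Mult}(\mathcal H)$ and $\|f\|_{\operatorname{Mult}(\mathcal H)} = \|f\|_{\mathcal H}$.
   Context: Reproducing kernel Hilbert spaces are separable complex Hilbert spaces of functions on a set. For such a space $\mathcal H$ on $X$ with kernel $K$, $\operatorname{Mult}(\mathcal H)$ is the algebra of all $\varphi : X \to \mathbb C$ with $\varphi f \in \mathcal H$ for all $f \in \mathcal H$, with norm $\|\varphi\|_{\operatorname{Mult}(\mathcal H)}=\|M_\varphi\|$, $M_\varphi f=\varphi f$. $\mathcal H$ is irreducible if $K(x,y) \ne 0$ for all $x,y\in X$ and $K(\cdot,x),K(\cdot,y)$ are linearly independent for $x\neq y$. $\mathcal H$ is a complete Nevanlinna-Pick space if for all $n,r \ge 1$, $z_1,\dots,z_n\in X$ and $\Lambda_1,\dots,\Lambda_n \in M_r(\mathbb C)$ such that the block matrix $\big(K(z_i,z_j)(1-\Lambda_i\Lambda_j^* )\big)_{i,j}$ is positive semidefinite, there is $\Phi \in M_r(\operatorname{Mult}(\mathcal H))$ of norm at most $1$ (as an operator on $\mathcal H\otimes\mathbb C^r$) with $\Phi(z_i)=\Lambda_i$ for all $i$. Let the circle group $\mathbb T$ act on $X$. $K$ is $\mathbb T$-invariant if $\lambda\mapsto K(\lambda z,w)$ is continuous on $\mathbb T$ for all $z,w\in X$ and $K(\lambda z,\lambda w)=K(z,w)$ for all $\lambda\in\mathbb T$, $z,w\in X$. In this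 case, for $n\in\mathbb Z$, let $\mathcal H_n=\{f\in\mathcal H: f(\lambda z)=\lambda^n f(z)\text{ for all }\lambda\in\mathbb T,\ z\in X\}$; elements of $\mathcal H_n$ are called homogeneous of degree $n$, and $\mathcal H=\bigoplus_{n\in\mathbb Z}\mathcal H_n$ (orthogonal sum). $\mathcal H$ is standard graded if $K$ is $\mathbb T$-invariant, $K$ is normalized at some point $x_0\in X$ (i.e. $K(x,x_0)=1$ for all $x\in X$), $\mathcal H_0=\mathbb C1$, and $\mathcal H_n=\{0\}$ for $n<0$. *)

(* Defs.v *)
From HB Require Import structures.
From mathcomp Require Import all_boot all_order all_algebra.
From mathcomp Require Import complex.
From mathcomp Require Import all_classical all_reals all_analysis.

Set Implicit Arguments.
Unset Strict Implicit.
Unset Printing Implicit Defensive.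

Import Order.TTheory GRing.Theory Num.Theory Num.Def.
Import numFieldNormedType.Exports.

Local Open Scope classical_set_scope.
Local Open Scope ring_scope.
Local Open Scope complex_scope.
Local Open Scope sesquilinear_scope.

(* A separable complex Hilbert space [hspace] realized, via the injective
   linear map [ev], as a space of functions on X.  The inner product is linear
   in its first argument.  The vectors [kvec y] are the kernel functions
   K(., y); by the Riesz theorem their existence says exactly that point
   evaluations are bounded, and they are determined by the other fields. *)
Record rkhs (R : realType) (X : Type) := Rkhs {
  hspace : completeNormedModType R[i];
  ip : {dot hspace for conjC};
  ip_norm : forall f : hspace, `|f| ^+ 2 = ip f f;
  hseparable : exists2 D : set hspace, countable D & dense D;
  ev : {linear hspace -> (X -> R[i])};
  ev_inj : injective ev;
  kvec : X -> hspace;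
  reproducing : forall (f : hspace) (y : X), ev f y = ip f (kvec y)
}.

Section RKHS.
Variables (R : realType) (X : Type) (H : rkhs R X).

Definition rkernel (x y : X) : R[i] := ev H (kvec H y) x.

(* The norm of [hspace] takes its values in R[i]. *)
Definition hnorm (f : hspace H) : R := complex.Re `|f|.

Definition is_mult (phi : X -> R[i]) : Prop :=
  forall f : hspace H, exists g : hspace H, ev H g = phi \* ev H f.

Definition mult_norm (phi : X -> R[i]) : \bar R :=
  ereal_sup [set (hnorm g)%:E | g in [set g : hspace H |
    exists2 f : hspace H, hnorm f <= 1 & ev H g = phi \* ev H f]].

(* H tensor C^r is the space of r-tuples of vectors with the l^2 norm. *)
Definition hnorm_vec (r : nat) (F : 'I_r -> hspace H) : R :=
  Num.sqrt (\sum_(i < r) hnorm (F i) ^+ 2).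

Definition mx_mult_norm (r : nat) (Phi : 'M[X -> R[i]]_r) : \bar R :=
  ereal_sup [set (hnorm_vec G)%:E | G in [set G : 'I_r -> hspace H |
    exists2 F : 'I_r -> hspace H, hnorm_vec F <= 1 &
      forall i x, ev H (G i) x = \sum_(j < r) Phi i j x * ev H (F j) x]].

Definition irreducible : Prop :=
  (forall x y, rkernel x y != 0) /\
  (forall x y, x <> y -> forall a b : R[i],
     a *: kvec H x + b *: kvec H y = 0 -> a = 0 /\ b = 0).

(* In R[i], [0 <= c] includes that c is real. *)
Definition psdmx (m : nat) (A : 'M[R[i]]_m) : Prop :=
  forall v : 'cV[R[i]]_m, 0 <= (v ^t* *m A *m v) 0 0.

Definition complete_NP : Prop :=
  forall n r : nat, (0 < n)%N -> (0 < r)%N ->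
  forall (z : 'I_n -> X) (L : 'I_n -> 'M[R[i]]_r),
    psdmx (\mxblock_(i < n, j < n)
             (rkernel (z i) (z j) *: (1%:M - L i *m (L j) ^t*))) ->
    exists Phi : 'M[X -> R[i]]_r,
      [/\ forall i j, is_mult (Phi i j),
          (mx_mult_norm Phi <= 1)%E &
          forall k : 'I_n, map_mx (fun phi => phi (z k)) Phi = L k].

End RKHS.

Definition circle (R : realType) : set R[i] := [set l | `|l| = 1].

(* Only the values of [act] at points of the circle are meaningful. *)
Record circle_action (R : realType) (X : Type) := CircleAction {
  act : R[i] -> X -> X;
  act1 : forall z, act 1 z = z;
  actM : forall l m z, circle l -> circle m -> act (l * m) z = act l (act m z)
}.

Section Graded.
Variables (R : realType) (X : Type) (T : circle_action R X) (H : rkhs R X).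

(* [R[i]^o] is R[i] with its norm topology. *)
Definition circle_invariant : Prop :=
  (forall z w : X, {within (circle (R := R) : set R[i]^o),
     continuous (fun l : R[i]^o => rkernel H (act T l z) w : R[i]^o)}) /\
  (forall l z w, circle l ->
     rkernel H (act T l z) (act T l w) = rkernel H z w).

Definition homogeneous (n : int) : set (hspace H) :=
  [set f | forall l z, circle l -> ev H f (act T l z) = l ^ n * ev H f z].

Definition standard_graded : Prop :=
  [/\ circle_invariant,
      exists x0, forall x, rkernel H x x0 = 1,
      [set ev H f | f in homogeneous 0] = [set cst c | c in [set: R[i]]] &
      forall n : int, n < 0 -> homogeneous n = [set 0]].

End Graded.

(* Main.v *)
Require Import Defs.
From HB Require Import structures.
From mathcomp Require Import all_boot all_order all_algebra.
From mathcomp Require Import complex.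
From mathcomp Require Import all_classical all_reals all_analysis.
From mathcomp Require Import cyclic separable cyclotomic ring lra.

(** Write K_n for the component of degree n of the kernel K, so that
    K_0 = 1 and K_n = 0 for n < 0, and put F = 1 - 1/K.

    The complete Nevanlinna-Pick property, with K normalized at a point,
    makes F positive semidefinite ([McCullough_Quiggin]).  Therefore
    F (K - 1) = K - 1 - F is positive semidefinite too, so F lies below K - 1
    and F_k = 0 for k <= 0 ([F_coefs]).  Splitting the identity K = 1 + F K
    into components, one gets K_n = F_1 K_(n-1) + ... + F_n K_0 for n >= 1.
    Hence
      K (1 - K_n) = 1 + K (F - F_1 - ... - F_n)
                      + F_1 K (1 - K_(n-1)) + ... + F_n K (1 - K_0),
    and by strong induction on n every summand on the right is positive
    semidefinite: the components F_k are, the remainder F - F_1 - ... - F_n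
    is by a Bessel inequality, and products are by Schur's theorem
    ([psd_mul_component]).

    If f is homogeneous of degree n with norm at most 1, then
    K(z,w) - f(z) conj f(w) is positive semidefinite, and so is its component
    of degree n, which is K_n(z,w) - f(z) conj f(w).  Multiplying by K and
    adding K (1 - K_n) shows that K(z,w) (1 - f(z) conj f(w)) is positive
    semidefinite.  By the Pick property f agrees on every finite set with a
    contractive multiplier, and weak compactness of balls in H makes f itself
    a contractive multiplier ([contractive_multiplier]).  The bound is attained
    because the constant function 1 is a kernel function of norm 1.

    Components are Fourier coefficients along the circle action.  The mean
    over the circle is defined as the limit of averages over the n-th roots of
    unity; a single estimate with the Fejer kernel ([fejer_approx]) yields
    existence and rotation invariance of this mean ([avg_rotation_cauchy])
    and the convolution formula for the coefficients of a product
    ([fourier_coef_convolution]), which is what makes the comparison of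
    components in K = 1 + F K legitimate. *)

Set Implicit Arguments.
Unset Strict Implicit.
Unset Printing Implicit Defensive.

Import Order.TTheory GRing.Theory Num.Theory Num.Def.
Import numFieldNormedType.Exports.

Local Open Scope classical_set_scope.
Local Open Scope ring_scope.

(** * Positive semidefinite kernels *)

Section PositiveKernels.
Local Open Scope sesquilinear_scope.
Variable C : numClosedFieldType.

(** Families are indexed by arbitrary finite types, so that points repeated
    along roots of unity (a product) and signed combinations of two families
    (a disjoint sum) need no renumbering. *)
Definition psd (T : Type) (L : T -> T -> C) :=
  forall (I : finType) (z : I -> T) (c : I -> C),
    0 <= \sum_i \sum_j (c i)^* * c j * L (z i) (z j).

Lemma psd_comp (S T : Type) (h : S -> T) (L : T -> T -> C) :
  psd L -> psd (fun x y => L (h x) (h y)).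
Proof. by move=> pL I z c; apply: (pL I (h \o z)). Qed.

Lemma eq_psd (T : Type) (L M : T -> T -> C) :
  (forall x y, L x y = M x y) -> psd L -> psd M.
Proof.
move=> LM pL I z c; have := pL I z c.
by under eq_bigr do under eq_bigr do rewrite LM.
Qed.

Lemma psd_ord (T : Type) (L : T -> T -> C) :
  (forall m (z : 'I_m -> T) (c : 'I_m -> C),
    0 <= \sum_i \sum_j (c i)^* * c j * L (z i) (z j)) -> psd L.
Proof.
move=> pL I z c; have := pL #|I| (z \o enum_val) (c \o enum_val).
congr (_ <= _); rewrite [RHS](reindex _ (onW_bij _ (@enum_val_bij I))) /=.
apply: eq_bigr => i _.
by rewrite [RHS](reindex _ (onW_bij _ (@enum_val_bij I))).
Qed.

Lemma psdD (T : Type) (L M : T -> T -> C) :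
  psd L -> psd M -> psd (fun x y => L x y + M x y).
Proof.
move=> pL pM I z c; under eq_bigr do under eq_bigr do rewrite mulrDr.
under eq_bigr do rewrite big_split /=.
by rewrite big_split addr_ge0 ?pL ?pM.
Qed.

Lemma psd0 (T : Type) : psd (fun _ _ : T => 0 : C).
Proof. by move=> I z c; rewrite big1 // => i _; rewrite big1// => j _; rewrite mulr0. Qed.

Lemma psd_sum (T : Type) (J : Type) (r : seq J) (P : pred J) (L : J -> T -> T -> C) :
  (forall k, P k -> psd (L k)) -> psd (fun x y => \sum_(k <- r | P k) L k x y).
Proof.
move=> pL; elim: r => [|k r IH].
  by apply: eq_psd (@psd0 T) => x y; rewrite big_nil.
apply: (@eq_psd _ (fun x y => (if P k then L k x y else 0) + \sum_(k <- r | P k) L k x y)).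
  by move=> x y; rewrite big_cons; case: ifP => // _; rewrite add0r.
by apply: psdD => //; have := pL k; case: (P k) => [/(_ isT)//|_]; exact: psd0.
Qed.

Lemma psd_rank1 (T : Type) (f : T -> C) : psd (fun x y => f x * (f y)^*).
Proof.
move=> I z c; have -> : \sum_i \sum_j (c i)^* * c j * (f (z i) * (f (z j))^*) =
  (\sum_i (c i)^* * f (z i)) * (\sum_i (c i)^* * f (z i))^*.
  rewrite rmorph_sum big_distrlr /=.
  by apply: eq_bigr => i _; apply: eq_bigr => j _; rewrite rmorphM /= conjCK; ring.
by rewrite mul_conjC_ge0.
Qed.

Lemma psd_conjmul (T : Type) (f : T -> C) (L : T -> T -> C) :
  psd L -> psd (fun x y => f x * (f y)^* * L x y).
Proof.
move=> pL I z c; have := pL I z (fun i => (f (z i))^* * c i); congr (_ <= _).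
apply: eq_bigr => i _; apply: eq_bigr => j _.
by rewrite rmorphM /= conjCK; ring.
Qed.

Lemma psd_two (T : Type) (L : T -> T -> C) (x y : T) (a b : C) : psd L ->
  0 <= a^* * a * L x x + a^* * b * L x y + (b^* * a * L y x + b^* * b * L y y).
Proof.
move=> /(_ bool (fun i => if i then x else y) (fun i => if i then a else b)).
by rewrite !big_bool.
Qed.

Lemma psd_diag (T : Type) (L : T -> T -> C) (x : T) : psd L -> 0 <= L x x.
Proof.
move=> /(_ unit (fun=> x) (fun=> 1)).
by rewrite (big_pred1 tt)// ?(big_pred1 tt)// ?conjC1 ?mul1r //; case.
Qed.

Lemma psd_conj (T : Type) (L : T -> T -> C) (x y : T) : psd L -> (L y x)^* = L x y.
Proof.
move=> pL; have /geC0_conj xx := psd_diag x pL; have /geC0_conj yy := psd_diag y pL.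
have /geC0_conj := psd_two x y 1 1 pL; have /geC0_conj := psd_two x y 1 'i pL.
rewrite !(rmorphD, rmorphM) /= ?conjCK !conjC1 !conjCi xx yy /= !mul1r.
set a := L x y; set b := L y x => e1 e2.
have : 'i * (2 * b^* - 2 * a) = 0.
  move/eqP: e1; rewrite -subr_eq0 => /eqP e1.
  move/eqP: e2; rewrite -subr_eq0 => /eqP e2.
  by have := congr2 +%R e1 (congr1 ( *%R 'i) e2); rewrite mulr0 addr0 => <-; ring.
move/eqP; rewrite mulf_eq0 (negbTE (neq0Ci C)) /= subr_eq0 => /eqP.
by apply: mulfI; rewrite pnatr_eq0.
Qed.

(** The determinant of the 2 by 2 form is obtained at the vector
    (L x y, - L x x), which carries a factor L x x; when this factor vanishes,
    a large multiple of L x y in the first slot forces L x y = 0. *)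
Lemma psd_CauchySchwarz (T : Type) (L : T -> T -> C) (x y : T) :
  psd L -> `|L x y| ^+ 2 <= L x x * L y y.
Proof.
move=> pL; have dx := psd_diag x pL; have dy := psd_diag y pL.
have cx := geC0_conj dx; have cy := geC0_conj dy.
have h := psd_two x y (L x y) (- L x x) pL.
have hyx : L y x = (L x y)^* by rewrite psd_conj.
have {}h : 0 <= L x x * (L x x * L y y - `|L x y| ^+ 2).
  move: h; congr (_ <= _); rewrite normCK rmorphN /= cx hyx; ring.
move: dx; rewrite le_eqVlt => /orP[/eqP x0|x0]; last first.
  by rewrite -subr_ge0; move: h; rewrite pmulr_rge0.
set a := L x y; set d := L y y; rewrite -x0 mul0r.
have [->|an0] := eqVneq a 0; first by rewrite normr0 expr0n.
have a0 : 0 < `|a| ^+ 2 by rewrite exprn_gt0 ?normr_gt0.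
have := psd_two x y (- (d / `|a| ^+ 2 + 1) * a) 1 pL.
have cr : (d / `|a| ^+ 2)^* = d / `|a| ^+ 2.
  by rewrite geC0_conj// divr_ge0// ltW.
rewrite -x0 hyx !mulr0 add0r rmorphM /= rmorphN rmorphD /= conjC1 cr -/a -/d.
have -> : - (d / `|a| ^+ 2 + 1) * a^* * 1 * a + (1 * (- (d / `|a| ^+ 2 + 1) * a) * a^* + 1 * 1 * d)
  = - d - 2 * `|a|^+2.
  by rewrite normCK; field; rewrite an0 conjC_eq0 an0.
rewrite -opprD oppr_ge0 => /le_gtF.
by rewrite ltr_wpDl// mulr_gt0// ltr0n.
Qed.

(** Repeated indices only group the coefficients together. *)
Lemma psd_of_form m (A : 'I_m -> 'I_m -> C) :
  (forall c : 'I_m -> C, 0 <= \sum_i \sum_j (c i)^* * c j * A i j) -> psd A.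
Proof.
move=> pA I z c; pose d k := \sum_(i | z i == k) c i.
have dE (F : 'I_m -> C) (b : I -> C) :
    \sum_i b i * F (z i) = \sum_k (\sum_(i | z i == k) b i) * F k.
  rewrite (partition_big z xpredT)//=; apply: eq_bigr => k _.
  by rewrite mulr_suml; apply: eq_bigr => i /eqP ->.
have := pA d; congr (_ <= _).
transitivity (\sum_i (c i)^* * \sum_k d k * A (z i) k); last first.
  apply: eq_bigr => i _; rewrite -dE mulr_sumr; apply: eq_bigr => j _.
  by rewrite mulrA.
rewrite (dE (fun a => \sum_k d k * A a k)); apply: eq_bigr => k _.
rewrite mulr_sumr; apply: eq_bigr => l _.
by rewrite /d rmorph_sum mulrA.
Qed.

(** The diagonal vanishes, hence everything by the Cauchy-Schwarz inequality. *)
Lemma psd_antisym (T : Type) (L : T -> T -> C) x y : psd L -> psd (fun z w => - L z w) -> L x y = 0.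
Proof.
move=> pL nL; have d z : L z z = 0.
  apply/eqP; rewrite eq_le (psd_diag z pL) andbT -oppr_ge0.
  exact: psd_diag z nL.
have := psd_CauchySchwarz x y pL; rewrite d mul0r => h.
by apply/eqP; rewrite -normr_eq0 -sqrf_eq0 eq_le h exprn_ge0.
Qed.

(** The matrix B is the square root of the spectral decomposition. *)
Lemma psd_gram m (A : 'I_m -> 'I_m -> C) : psd A ->
  exists B : 'I_m -> 'I_m -> C, forall i j, A i j = \sum_k (B k i)^* * B k j.
Proof.
move=> pA; pose M := \matrix_(i, j) A i j : 'M[C]_m.
have /hermitian_normalmx/orthomx_spectralP : M \is hermsymmx.
  apply/is_hermitianmxP/matrixP => i j; rewrite expr0 scale1r !mxE.
  by rewrite psd_conj.
set P := spectralmx M; set D := spectral_diag M.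
have Pu : P \is unitarymx by exact: spectral_unitarymx.
have PM : P *m P^t* = 1%:M by apply/unitarymxP.
rewrite invmx_unitary// => eM.
have D0 k : 0 <= D 0 k.
  have -> : D 0 k = (P *m M *m P^t*) k k.
    rewrite eM !mulmxA PM mul1mx -mulmxA PM mulmx1.
    by rewrite mxE eqxx mulr1n.
  have := pA _ id (fun j => (P k j)^*); congr (_ <= _).
  rewrite mxE exchange_big /=; apply: eq_bigr => j _; rewrite !mxE mulr_suml.
  by apply: eq_bigr => i _; rewrite !mxE conjCK; ring.
exists (fun k i => sqrtC (D 0 k) * P k i) => i j.
transitivity (M i j); first by rewrite mxE.
rewrite eM mxE; apply: eq_bigr => k _.
have sD : (sqrtC (D 0 k))^* = sqrtC (D 0 k) by rewrite geC0_conj ?sqrtC_ge0.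
by rewrite mul_mx_diag !mxE rmorphM /= sD -[in LHS](sqrtCK (D 0 k)); ring.
Qed.

(** Schur's product theorem: a Gram decomposition of one factor turns the
    form of the product into a sum of forms of the other factor. *)
Lemma psdM (T : Type) (L M : T -> T -> C) :
  psd L -> psd M -> psd (fun x y => L x y * M x y).
Proof.
move=> pL pM; apply: psd_ord => m z c.
have [B eB] := psd_gram (psd_comp z pL).
have -> : \sum_i \sum_j (c i)^* * c j * (L (z i) (z j) * M (z i) (z j)) =
   \sum_k \sum_i \sum_j (B k i * c i)^* * (B k j * c j) * M (z i) (z j).
  rewrite [RHS]exchange_big; apply: eq_bigr => i _; rewrite [RHS]exchange_big /=.
  apply: eq_bigr => j _; rewrite eB mulr_suml mulr_sumr; apply: eq_bigr => k _.
  by rewrite rmorphM /=; ring.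
by apply: sumr_ge0 => k _; apply: pM.
Qed.

End PositiveKernels.

(** * Averages over roots of unity and the mean on the circle *)

Section CircleMeans.
Variable R : realType.
Local Notation C := (R[i] : numClosedFieldType).

Lemma prim_root_exists (n : nat) : (0 < n)%N -> {z : C | n.-primitive_root z}.
Proof.
move=> n0; apply/cid; pose p : {poly C} := 'X^n - 1.
have [r Dp] := closed_field_poly_normal p.
rewrite (monicP _) ?monicXnsubC // scale1r in Dp.
have rn1 : all n.-unity_root r by apply/allP=> z; rewrite -root_prod_XsubC -Dp.
have sz_r : (n < (size r).+1)%N.
  by rewrite -(size_prod_XsubC r id) -Dp size_XnsubC.
have [|z] := hasP (has_prim_root n0 rn1 _ sz_r); last by exists z.
by rewrite -separable_prod_XsubC -Dp separable_Xn_sub_1 // pnatr_eq0 -lt0n.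
Qed.

Definition omega (n : nat) : C := sval (prim_root_exists (ltn0Sn n)).

Lemma omegaP n : n.+1.-primitive_root (omega n).
Proof. by rewrite /omega; case: prim_root_exists. Qed.

Lemma norm_omega n : `|omega n| = 1.
Proof.
apply/eqP; rewrite -(pexpr_eq1 (n := n.+1))//; first by rewrite -normrX prim_expr_order ?normr1 ?omegaP.
Qed.

Lemma norm_omegaX n j : `|omega n ^+ j| = 1.
Proof. by rewrite normrX norm_omega expr1n. Qed.

Definition avg (V : lmodType C) (n : nat) (u : C -> V) : V :=
  n.+1%:R^-1 *: \sum_(j < n.+1) u (omega n ^+ j).

Lemma circle_conjV (x : C) : `|x| = 1 -> x^* = x^-1.
Proof. by move=> x1; rewrite invC_norm x1 expr1n invr1 mul1r. Qed.

(** A geometric sum of ratio omega^(i-j), which is not 1 unless i = j because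
    both exponents are less than n + 1. *)
Lemma omega_orthogonality n (i j : nat) : (i <= n)%N -> (j <= n)%N ->
  \sum_(l < n.+1) (omega n ^+ l) ^+ i * ((omega n ^+ l)^*) ^+ j = (i == j)%:R *+ n.+1.
Proof.
move=> iN jN; set w := omega n; have w1 : `|w| = 1 by exact: norm_omega.
have w0 : w != 0 by rewrite -normr_eq0 w1 oner_eq0.
pose r := w ^+ i * (w ^- j).
have -> : \sum_(l < n.+1) (w ^+ l) ^+ i * ((w ^+ l)^*) ^+ j = \sum_(l < n.+1) r ^+ l.
  apply: eq_bigr => l _; rewrite circle_conjV ?norm_omegaX// /r.
  by rewrite exprMn -!exprVn -!exprM ![(l * _)%N]mulnC.
have [eij|nij] := eqVneq i j.
  rewrite (eq_bigr (fun=> 1)) ?sumr_const ?card_ord// => l _.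
  by rewrite /r eij divff ?expf_neq0// expr1n.
have r1 : r - 1 != 0.
  rewrite subr_eq0; apply: contra nij => /eqP e.
  have : w ^+ i == w ^+ j by rewrite -[w ^+ j]mul1r -e /r mulfVK// expf_neq0.
  by rewrite (eq_prim_root_expr (omegaP n)) !modn_small.
rewrite mul0rn; apply: (mulfI r1); rewrite mulr0 -subrX1.
have -> : r ^+ n.+1 = 1; last by rewrite subrr.
rewrite /r exprMn exprVn -!exprM ![(_ * n.+1)%N]mulnC !exprM.
by rewrite (prim_expr_order (omegaP n)) !expr1n invr1 mulr1.
Qed.

(** The Fejer kernel, written as a square so that it is visibly nonnegative and
    small away from 1. *)
Definition fejer (M : nat) (x : C) : C := M.+1%:R^-1 * `|\sum_(i < M.+1) x ^+ i| ^+ 2.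

Lemma fejer_ge0 M x : 0 <= fejer M x.
Proof. by rewrite mulr_ge0 ?invr_ge0 ?exprn_ge0. Qed.

Lemma fejerE M x : fejer M x =
  M.+1%:R^-1 * \sum_(i < M.+1) \sum_(j < M.+1) x ^+ i * (x^*) ^+ j.
Proof.
rewrite /fejer normCK rmorph_sum big_distrlr /=; congr (_ * _).
by apply: eq_bigr => i _; apply: eq_bigr => j _; rewrite rmorphXn.
Qed.

Lemma fejer_conj M x : fejer M x^* = fejer M x.
Proof.
rewrite /fejer -[in RHS]norm_conjC rmorph_sum; congr (_ * `|_| ^+ 2).
by apply: eq_bigr => i _; rewrite rmorphXn.
Qed.

(** The discrete average of the Fejer kernel is exactly 1 along any rotated
    copy of the n-th roots of unity, as soon as these resolve its
    frequencies; exactness for every rotation [a] is what makes averages of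
    different orders comparable in [avg_rotation_cauchy]. *)
Lemma sum_fejer M n a : (M <= n)%N -> `|a| = 1 ->
  \sum_(l < n.+1) fejer M (a * omega n ^+ l) = n.+1%:R.
Proof.
move=> Mn a1; under eq_bigr do rewrite fejerE.
rewrite -mulr_sumr exchange_big /=.
under eq_bigr => i _.
  rewrite exchange_big /=.
  under eq_bigr => j _.
    under eq_bigr => l _ do rewrite rmorphM !exprMn mulrACA.
    rewrite -mulr_sumr omega_orthogonality ?(leq_trans _ Mn) -1?ltnS//.
    over.
  rewrite (bigD1 i)//= eqxx big1 ?addr0; last first.
    by move=> j /negbTE; rewrite eq_sym -val_eqE /= => ->; rewrite mul0rn mulr0.
  rewrite -exprMn -normCK a1 !expr1n mul1r.
  over.
by rewrite sumr_const card_ord -[X in _ * X]mulr_natl mulKf // pnatr_eq0.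
Qed.

(** The geometric sum has modulus at most 2 / |x - 1|. *)
Lemma fejer_le_far M (x d : C) : `|x| = 1 -> 0 < d -> d <= `|x - 1| ->
  fejer M x <= M.+1%:R^-1 * (4 / d ^+ 2).
Proof.
move=> x1 d0 dx; rewrite ler_wpM2l ?invr_ge0//.
rewrite ler_pdivlMr ?exprn_gt0// -exprMn.
have -> : (4 : C) = 2 ^+ 2 by rewrite expr2 -natrM.
rewrite lerXn2r ?nnegrE ?mulr_ge0// ?(ltW d0)//.
apply: (@le_trans _ _ (`|\sum_(i < M.+1) x ^+ i| * `|x - 1|)).
  by rewrite ler_wpM2l.
rewrite -normrM mulrC -subrX1 (le_trans (ler_normB _ _))//.
by rewrite normrX x1 expr1n normr1.
Qed.

Lemma invS_mul_small (e B : C) : 0 < e -> 0 <= B -> exists M0, forall M, (M0 <= M)%N ->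
  M.+1%:R^-1 * B <= e.
Proof.
move=> e0 B0.
have eR : e = (complex.Re e)%:C%C by rewrite RRe_real ?gtr0_real.
have BR : B = (complex.Re B)%:C%C by rewrite RRe_real ?ger0_real.
move: e0 B0; rewrite eR BR ltcR lecR; set e' := complex.Re e; set B' := complex.Re B.
move=> e0 B0; exists (Num.bound (B' / e')) => M hM.
have -> : M.+1%:R = (M.+1%:R : R)%:C%C :> C by rewrite rmorph_nat.
rewrite -fmorphV -rmorphM lecR ler_pdivrMl// -ler_pdivrMr//.
have /archi_boundP/ltW/le_trans : 0 <= B' / e' by rewrite divr_ge0// ltW.
by apply; rewrite ler_nat (leq_trans hM).
Qed.

Section Vector.
Variable V : normedModType C.

(** Boundedness is included because products, and the Fejer estimate away from
    the point of interest, rely on it. *)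
Definition ucont (u : C -> V) :=
  (exists B, forall l, `|l| = 1 -> `|u l| <= B) /\
  forall e, 0 < e -> exists2 d : C, 0 < d & forall l m, `|l| = 1 -> `|m| = 1 ->
     `|l - m| < d -> `|u l - u m| <= e.

Lemma norm_avg_le n (u : C -> V) B :
  (forall l, `|l| = 1 -> `|u l| <= B) -> `|avg n u| <= B.
Proof.
move=> uB; rewrite /avg normrZ ger0_norm ?invr_ge0//.
rewrite ler_pdivrMl ?ltr0n//; apply: le_trans (ler_norm_sum _ _ _) _.
have -> : n.+1%:R * B = \sum_(j < n.+1) B by rewrite sumr_const card_ord mulr_natl.
by apply: ler_sum => j _; apply: uB; exact: norm_omegaX.
Qed.

Lemma avg_linear n (a : C) (u v : C -> V) :
  avg n (fun l => a *: u l + v l) = a *: avg n u + avg n v.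
Proof.
by rewrite /avg big_split /= -scaler_sumr scalerDr !scalerA mulrC.
Qed.

Lemma avgB n (u v : C -> V) : avg n (fun l => u l - v l) = avg n u - avg n v.
Proof. by rewrite /avg sumrB scalerBr. Qed.

Definition fejer_mean (M n : nat) (u : C -> V) (l : C) : V :=
  avg n (fun w => fejer M (l * w^-1) *: u w).

(** The quantitative Fejer theorem with sums in place of integrals.  The degree
    M0 depends only on the modulus of continuity and the bound of [u], neither
    on the order of the roots of unity nor on the point of the circle. *)
Lemma fejer_approx u (e : C) : ucont u -> 0 < e ->
  exists M0, forall M n l, (M0 <= M <= n)%N -> `|l| = 1 ->
    `|fejer_mean M n u l - u l| <= e.
Proof.
move=> [[B uB] uc] e0; have e20 : 0 < e / 2 by rewrite divr_gt0.
have [d d0 ud] := uc _ e20.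
have B0 : 0 <= B by apply: le_trans (uB 1 (normr1 _)).
have B'0 : 0 <= 4 / d ^+ 2 * (2 * B) by rewrite !mulr_ge0// invr_ge0 exprn_ge0 ?ltW.
have [M0 hM0] := invS_mul_small e20 B'0.
exists M0 => M n l /andP[hM Mn] l1.
have sumf : \sum_(j < n.+1) fejer M (l * (omega n ^+ j)^-1) = n.+1%:R.
  rewrite -(@sum_fejer M n l^*) ?norm_conjC//; apply: eq_bigr => j _.
  by rewrite -circle_conjV ?norm_omegaX// -fejer_conj rmorphM /= conjCK.
have -> : fejer_mean M n u l - u l = avg n (fun w => fejer M (l * w^-1) *: (u w - u l)).
  rewrite /fejer_mean /avg; under [in RHS]eq_bigr do rewrite scalerBr.
  by rewrite sumrB scalerBr -scaler_suml sumf scalerA mulVf ?scale1r// pnatr_eq0.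
rewrite /avg normrZ ger0_norm ?invr_ge0// ler_pdivrMl ?ltr0n//.
apply: le_trans (ler_norm_sum _ _ _) _.
have -> : n.+1%:R * e = \sum_(j < n.+1) (fejer M (l * (omega n ^+ j)^-1) * (e / 2) + e / 2).
  rewrite big_split /= -mulr_suml sumf sumr_const card_ord -[X in _ + X]mulr_natl -mulrDr.
  by rewrite -splitr.
apply: ler_sum => j _; set w := omega n ^+ j; have w1 : `|w| = 1 by exact: norm_omegaX.
have w0 : w != 0 by rewrite -normr_eq0 w1 oner_eq0.
rewrite normrZ ger0_norm ?fejer_ge0//.
have [dl|dl] := boolP (`|w - l| < d).
  rewrite ler_wpDr ?(ltW e20)// ler_wpM2l ?fejer_ge0//; exact: ud.
rewrite ler_wpDl ?(mulr_ge0 (fejer_ge0 _ _) (ltW e20))//.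
have {}dl : d <= `|l * w^-1 - 1|.
  have -> : l * w^-1 - 1 = (l - w) / w by rewrite mulrBl divff.
  rewrite normrM normfV w1 invr1 mulr1 distrC real_leNgt ?normr_real//.
  by rewrite gtr0_real.
have lw1 : `|l * w^-1| = 1 by rewrite normrM normfV l1 w1 invr1 mulr1.
apply: le_trans _ (hM0 _ hM); rewrite mulrA; apply: ler_pM; rewrite ?fejer_ge0//.
  exact: fejer_le_far.
by rewrite (le_trans (ler_normB _ _))// mulr_natl mulr2n lerD ?uB.
Qed.

(** Averaging the Fejer mean of order m over n rotated roots of unity gives back
    the average of order m, since the two sums can be exchanged; the Fejer mean
    being uniformly close to [u], the averages of orders n and m are close. *)
Lemma avg_rotation_cauchy u (e : C) : ucont u -> 0 < e ->
  exists M0, forall n m a, (M0 <= n)%N -> (M0 <= m)%N -> `|a| = 1 ->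
    `|avg n (fun l => u (a * l)) - avg m u| <= e.
Proof.
move=> uu e0; have [M0 hM0] := fejer_approx uu e0.
exists M0 => n m a hn hm a1.
have -> : avg m u = avg n (fun l => fejer_mean M0 m u (a * l)).
  rewrite /fejer_mean /avg -scaler_sumr scalerA mulrC -scalerA; congr (_ *: _).
  rewrite exchange_big /= scaler_sumr; apply: eq_bigr => j _.
  rewrite -scaler_suml; under eq_bigr do rewrite mulrAC.
  by rewrite sum_fejer// ?scalerA ?mulVf ?scale1r ?pnatr_eq0// normrM normfV a1 norm_omegaX invr1 mulr1.
rewrite -avgB; apply: norm_avg_le => l l1; rewrite distrC.
by apply: hM0; rewrite ?leqnn ?hm// normrM a1 l1 mulr1.
Qed.

(** Convergence is required uniformly in the rotation [a]; this builds rotation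
    invariance into the notion. *)
Definition is_mean (u : C -> V) (v : V) := forall e, 0 < e ->
  exists M0, forall n a, (M0 <= n)%N -> `|a| = 1 -> `|avg n (fun l => u (a * l)) - v| <= e.

End Vector.

Lemma mean_exists (V : completeNormedModType C) (u : C -> V) : ucont u -> exists v, is_mean u v.
Proof.
move=> uu; have /cauchy_cvg : cauchy ((fun n => avg n u) @ \oo).
  apply: cauchy_exP => e e0; have e20 : 0 < e / 2 by rewrite divr_gt0.
  have [M0 hM0] := avg_rotation_cauchy uu e20; exists (avg M0 u); exists M0 => // n hn.
  rewrite -ball_normE /=; apply: (@le_lt_trans _ _ (e / 2)); last first.
    by rewrite ltr_pdivrMr// ltr_pMr// ltr1n.
  rewrite distrC; have := hM0 n M0 1 hn (leqnn _) (normr1 _).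
  by under [X in `|avg _ X - _|]eq_fun do rewrite mul1r.
set v := lim _ => cv; exists v => e e0; have e20 : 0 < e / 2 by rewrite divr_gt0.
have [M0 hM0] := avg_rotation_cauchy uu e20.
have /cvgrPdist_le/(_ _ e20)[M1 _ hM1] : (fun n => avg n u) @ \oo --> v by [].
exists (maxn M0 M1) => n a hn a1; rewrite -(subrKA (avg (maxn M0 M1) u)).
rewrite (splitr e) (le_trans (ler_normD _ _))// lerD//.
  by apply: hM0 => //; rewrite ?leq_maxl// (leq_trans (leq_maxl _ _) hn).
by rewrite distrC; apply: hM1; rewrite /= leq_maxr.
Qed.

End CircleMeans.

Section UniformContinuity.
Variable R : realType.
Local Notation C := (R[i] : numClosedFieldType).

Lemma ucontZ (V : normedModType C) (a : C -> R[i]^o) (u : C -> V) :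
  ucont a -> ucont u -> ucont (fun l => a l *: u l).
Proof.
move=> [[A aA] ac] [[B uB] uc]; split.
  exists (A * B) => l l1; rewrite normrZ; apply: ler_pM => //; [exact: aA | exact: uB].
move=> e e0; have e20 := divr_gt0 e0 (ltr0n C 2).
have A0 : 0 <= A by apply: le_trans (aA 1 (normr1 _)).
have B0 : 0 <= B by apply: le_trans (uB 1 (normr1 _)).
have A1 : 0 < A + 1 by rewrite ltr_wpDl.
have B1 : 0 < B + 1 by rewrite ltr_wpDl.
have [d1 d10 h1] := ac _ (divr_gt0 e20 B1); have [d2 d20 h2] := uc _ (divr_gt0 e20 A1).
have [d d0 [dd1 dd2]] : exists2 d : C, 0 < d & d <= d1 /\ d <= d2.
  have r1 : d1 \is Num.real by rewrite gtr0_real.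
  have r2 : d2 \is Num.real by rewrite gtr0_real.
  have [h|h] := real_leP r1 r2; first by exists d1.
  by exists d2 => //; split => //; exact: ltW.
exists d => // l m l1 m1 lm.
have -> : a l *: u l - a m *: u m = (a l - a m) *: u l + a m *: (u l - u m).
  by rewrite scalerBl scalerBr addrA subrK.
rewrite (splitr e) (le_trans (ler_normD _ _))// !normrZ lerD//.
  apply: (@le_trans _ _ (e / 2 / (B + 1) * B)).
    by apply: ler_pM => //; [apply: h1 => //; exact: lt_le_trans lm _ | exact: uB].
  by rewrite -mulrA ler_piMr ?(ltW e20)// mulrC ler_pdivrMr// mul1r ler_wpDr.
apply: (@le_trans _ _ (A * (e / 2 / (A + 1)))).
  by apply: ler_pM => //; [exact: aA | apply: h2 => //; exact: lt_le_trans lm _].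
by rewrite mulrCA ler_piMr ?(ltW e20)// ler_pdivrMr// mul1r ler_wpDr.
Qed.

Lemma ucont_lipschitz (V W : normedModType C) (u : C -> V) (v : C -> W) (A B : C) :
  ucont u -> (forall l, `|l| = 1 -> `|v l| <= A) -> 0 <= B ->
  (forall l m, `|l| = 1 -> `|m| = 1 -> `|v l - v m| <= B * `|u l - u m|) -> ucont v.
Proof.
move=> [_ uc] vA B0 vu; split; first by exists A.
move=> e e0; have B1 : 0 < B + 1 by rewrite ltr_wpDl.
have [d d0 hd] := uc _ (divr_gt0 e0 B1); exists d => // l m l1 m1 lm.
apply: le_trans (vu _ _ l1 m1) _; apply: (@le_trans _ _ (B * (e / (B + 1)))).
  by rewrite ler_wpM2l// hd.
by rewrite mulrCA ler_piMr ?(ltW e0)// ler_pdivrMr// mul1r ler_wpDr.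
Qed.

Lemma ucont_cst (V : normedModType C) (v : V) : ucont (fun=> v).
Proof.
split; first by exists `|v|.
by move=> e e0; exists 1 => // l m _ _ _; rewrite subrr normr0 ltW.
Qed.

Lemma ucont_id : ucont (fun l : C => l : R[i]^o).
Proof.
split; first by exists 1 => l ->.
by move=> e e0; exists e => // l m _ _ /ltW.
Qed.

Lemma dist_circleV (l m : C) : `|l| = 1 -> `|m| = 1 -> `|l^-1 - m^-1| = `|l - m|.
Proof. by move=> l1 m1; rewrite -!circle_conjV// -rmorphB norm_conjC. Qed.

Lemma ucontV (V : normedModType C) (u : C -> V) : ucont u -> ucont (fun l => u l^-1).
Proof.
move=> [[B uB] uc]; split; first by exists B => l l1; rewrite uB// normfV l1 invr1.
move=> e e0; have [d d0 h] := uc e e0; exists d => // l m l1 m1 lm.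
by apply: h; rewrite ?dist_circleV// normfV ?l1 ?m1 invr1.
Qed.

Lemma ucontX (k : int) : ucont (fun l : C => l ^ k : R[i]^o).
Proof.
have natX (n : nat) : ucont (fun l : C => l ^+ n : R[i]^o).
  elim: n => [|n IH]; first exact: ucont_cst.
  by have := ucontZ ucont_id IH; congr ucont; apply/funext => l; rewrite exprS.
case: k => n; first exact: natX.
have := ucontV (natX n.+1); congr ucont; apply/funext => l.
by rewrite exprVn NegzE.
Qed.

End UniformContinuity.

(** * Fourier coefficients on the circle *)

Section FourierCoefficients.
Variable R : realType.
Local Notation C := (R[i] : numClosedFieldType).

Lemma norm_le_eps (V : normedModType C) (v : V) :
  (forall e : C, 0 < e -> `|v| <= e) -> v = 0.
Proof.
move=> h; apply/eqP; rewrite -normr_eq0; apply/negPn/negP => v0.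
have v0' : 0 < `|v| by rewrite lt_def v0 normr_ge0.
have := h (`|v| / 2) (divr_gt0 v0' (ltr0n _ 2)).
by rewrite ler_pdivlMr// -subr_ge0 mulr_natr mulr2n opprD addNKr oppr_ge0 (lt_geF v0').
Qed.

(** The order on complex numbers is partial, so a limit of nonnegative numbers
    has to be shown real as well: it equals its own modulus. *)
Lemma ge0_limit (q : C) :
  (forall e : C, 0 < e -> exists2 y : C, 0 <= y & `|y - q| <= e) -> 0 <= q.
Proof.
move=> h; suff : (q : C^o) - `|q| = 0 by move/eqP; rewrite subr_eq0 => /eqP ->.
apply: norm_le_eps => e e0; have [y y0 yq] := h (e / 2) (divr_gt0 e0 (ltr0n _ 2)).
rewrite -(subrKA y) (splitr e) (le_trans (ler_normD _ _))// lerD ?[`|q - y|]distrC//.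
by rewrite -{1}(ger0_norm y0) (le_trans (ler_dist_dist _ _)).
Qed.

Section Vector.
Variable V : normedModType C.
Implicit Types u : C -> V.

Lemma is_mean_unique u v w : is_mean u v -> is_mean u w -> v = w.
Proof.
move=> hv hw; apply/eqP; rewrite -subr_eq0; apply/eqP/norm_le_eps => e e0.
have e20 := divr_gt0 e0 (ltr0n _ 2).
have [M1 h1] := hv _ e20; have [M2 h2] := hw _ e20.
have := h1 (maxn M1 M2) 1 (leq_maxl _ _) (normr1 _).
have := h2 (maxn M1 M2) 1 (leq_maxr _ _) (normr1 _).
set a := avg _ _ => l2 l1; rewrite -(subrKA a) (splitr e).
by rewrite (le_trans (ler_normD _ _))// lerD// distrC.
Qed.

Lemma eq_is_mean u u' v : (forall l, `|l| = 1 -> u l = u' l) -> is_mean u v -> is_mean u' v.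
Proof.
move=> uu h e e0; have [M hM] := h e e0; exists M => n a hn a1.
rewrite (_ : avg n _ = avg n (fun l => u (a * l))); first exact: hM.
by rewrite /avg; congr (_ *: _); apply: eq_bigr => j _; rewrite uu// normrM a1 norm_omegaX mulr1.
Qed.

Lemma is_mean_rot u v b : `|b| = 1 -> is_mean u v -> is_mean (fun l => u (b * l)) v.
Proof.
move=> b1 h e e0; have [M hM] := h e e0; exists M => n a hn a1.
have := hM n (b * a) hn; rewrite normrM b1 a1 mulr1 => /(_ erefl).
by under [X in `|avg _ X - _|]eq_fun do rewrite -mulrA.
Qed.

Lemma is_meanZD c u u' v v' : is_mean u v -> is_mean u' v' ->
  is_mean (fun l => c *: u l + u' l) (c *: v + v').
Proof.
move=> h h' e e0.
have c10 : 0 < `|c| + 1 by rewrite ltr_wpDl.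
have e20 := divr_gt0 e0 (ltr0n C 2).
have ec0 : 0 < e / 2 / (`|c| + 1) by rewrite divr_gt0.
have [M1 h1] := h _ ec0; have [M2 h2] := h' _ e20.
exists (maxn M1 M2) => n a; rewrite geq_max => /andP[n1 n2] a1.
rewrite avg_linear opprD addrACA -scalerBr (splitr e) (le_trans (ler_normD _ _))// lerD//.
  rewrite normrZ; apply: (@le_trans _ _ (`|c| * (e / 2 / (`|c| + 1)))).
    by rewrite ler_wpM2l//; apply: h1.
  by rewrite mulrCA ler_piMr ?(ltW e20)// ler_pdivrMr// mul1r ler_wpDr.
exact: h2.
Qed.

Lemma is_mean0 : is_mean (fun=> 0 : V) 0.
Proof.
by move=> e e0; exists 0%N => n a _ _; rewrite /avg big1// scaler0 subrr normr0 ltW.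
Qed.

Lemma is_mean_sum (I : Type) (r : seq I) (c : I -> C) (u : I -> C -> V) (v : I -> V) :
  (forall i, is_mean (u i) (v i)) ->
  is_mean (fun l => \sum_(i <- r) c i *: u i l) (\sum_(i <- r) c i *: v i).
Proof.
move=> h; elim: r => [|i r IH].
  rewrite big_nil; apply: eq_is_mean is_mean0 => l _; by rewrite big_nil.
rewrite big_cons; apply: eq_is_mean (is_meanZD (c i) (h i) IH) => l _.
by rewrite big_cons.
Qed.

Lemma is_mean_le u v B : (forall l, `|l| = 1 -> `|u l| <= B) -> is_mean u v -> `|v| <= B.
Proof.
move=> uB h; rewrite -subr_ge0.
have B0 : 0 <= B by apply: le_trans (uB 1 (normr1 _)).
rewrite subr_ge0 real_leNgt ?normr_real ?ger0_real//; apply/negP => vB.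
have e0 : 0 < (`|v| - B) / 2 by rewrite divr_gt0 ?subr_gt0.
have [M hM] := h _ e0; have {}hM := hM M 1 (leqnn _) (normr1 _).
have ul : `|avg M (fun l => u (1 * l))| <= B.
  by apply: norm_avg_le => l l1; rewrite mul1r uB.
have := lerB_dist v (avg M (fun l => u (1 * l))); rewrite distrC => /le_trans/(_ hM).
apply/negP; rewrite -real_ltNge ?realB ?normr_real// ?gtr0_real//.
apply: (@lt_le_trans _ _ (`|v| - B)); last by rewrite lerB.
by rewrite ltr_pdivrMr// ltr_pMr ?subr_gt0// ltr1n.
Qed.

End Vector.

Lemma is_mean_morph (V W : normedModType C) (f : {linear V -> W}) (B : C) u v :
  0 < B -> (forall x, `|f x| <= B * `|x|) -> is_mean u v -> is_mean (fun l => f (u l)) (f v).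
Proof.
move=> B0 fB h e e0; have [M hM] := h _ (divr_gt0 e0 B0).
exists M => n a hn a1; have -> : avg n (fun l => f (u (a * l))) = f (avg n (fun l => u (a * l))).
  by rewrite /avg linearZ /=; congr (_ *: _); rewrite raddf_sum.
rewrite -raddfB (le_trans (fB _))// mulrC -ler_pdivlMr//; exact: hM.
Qed.

Definition fourier_coef (u : C -> C) (k : int) (c : C) := @is_mean R C^o (fun l => l ^ (- k) * u l) c.

Lemma circle_neq0 (l : C) : `|l| = 1 -> l != 0.
Proof. by move=> l1; rewrite -normr_eq0 l1 oner_eq0. Qed.

Lemma norm_circleX (l : C) (k : int) : `|l| = 1 -> `|l ^ k| = 1.
Proof. by move=> l1; case: k => n; rewrite ?NegzE -?exprnN -?exprnP ?normfV normrX l1 expr1n ?invr1. Qed.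

Lemma fourier_coef_mono (m k : int) : fourier_coef (fun l => l ^ m) k (m == k)%:R.
Proof.
move=> e e0; exists `|m - k|%N => n a hn a1.
suff -> : avg n (fun l => (a * l) ^ (- k) * (a * l) ^ m : C^o) = (m == k)%:R.
  by rewrite subrr normr0 ltW.
have ek l : `|l| = 1 -> (a * l) ^ (- k) * (a * l) ^ m = a ^ (m - k) * l ^ (m - k).
  move=> l1; rewrite -expfzDr ?mulf_neq0 ?circle_neq0// addrC.
  by rewrite exprMz_comm ?unitfE ?circle_neq0//; apply: mulrC.
rewrite /avg; under eq_bigr => j _ do rewrite (ek _ (norm_omegaX _ _ _)).
rewrite -mulr_sumr.
have -> : \sum_(j < n.+1) (omega R n ^+ j) ^ (m - k) = (m == k)%:R *+ n.+1.
  rewrite -[m == k]subr_eq0; move: (m - k) hn => [p|p] hn.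
    rewrite -(@omega_orthogonality R n p 0)//; apply: eq_bigr => j _.
    by rewrite expr0 mulr1.
  rewrite (_ : (Negz p == 0) = (0 == p.+1)%N)// -omega_orthogonality//; apply: eq_bigr => j _.
  by rewrite expr0 mul1r circle_conjV ?norm_omegaX// NegzE -exprnN exprVn.
have [->|mk] := eqVneq m k.
  by rewrite subrr expr0z mul1r /GRing.scale /= mulVf// pnatr_eq0.
by rewrite mul0rn mulr0 scaler0.
Qed.

(** As the order n of the roots of unity grows, the Fejer mean of degree M tends
    to the Cesaro sum of the Fourier series, here indexed by pairs (i, j) with
    difference i - j instead of with weights. *)
Lemma fejer_sum_limit (u : C -> C) (U : int -> C) (M : nat) (l e : C) :
  (forall k, fourier_coef u k (U k)) -> `|l| = 1 -> 0 < e ->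
  exists n0, forall n, (n0 <= n)%N ->
   `|fejer_mean (V := C^o) M n u l - M.+1%:R^-1 * \sum_(i < M.+1) \sum_(j < M.+1) U (i%:Z - j%:Z) * l ^ (i%:Z - j%:Z)| <= e.
Proof.
move=> hU l1 e0.
have h : @is_mean R C^o (fun w => fejer M (l * w^-1) *: (u w : C^o))
   (\sum_(p : 'I_M.+1 * 'I_M.+1) (M.+1%:R^-1 * l ^ (p.1%:Z - p.2%:Z)) *: (U (p.1%:Z - p.2%:Z) : C^o)).
  have ms := is_mean_sum (u := fun (p : 'I_M.+1 * 'I_M.+1) (w : C) => w ^ (- (p.1%:Z - p.2%:Z)) * u w : C^o) _ _ (fun p : 'I_M.+1 * 'I_M.+1 => hU (p.1%:Z - p.2%:Z)).
  apply: eq_is_mean (ms _ _) => w w1.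
  rewrite fejerE pair_big /= mulr_sumr /GRing.scale /= mulr_suml.
  apply: eq_bigr => -[i j] _ /=.
  rewrite mulrA; congr (_ * _); rewrite -mulrA; congr (_ * _).
  have l0 := circle_neq0 l1; have w0 := circle_neq0 w1.
  rewrite circle_conjV ?normrM ?normfV ?l1 ?w1 ?invr1 ?mulr1//.
  rewrite invfM invrK opprB !expfzDr// -!exprnN -!exprnP !exprMn !exprVn.
  by rewrite [w ^+ j / _]mulrC mulrACA.
have [n0 hn0] := h e e0; exists n0 => n hn.
have := hn0 n 1 hn (normr1 _); rewrite /fejer_mean.
under [X in `|avg _ X - _|]eq_fun do rewrite mul1r.
congr (`|_ - _| <= _); rewrite pair_big /= mulr_sumr; apply: eq_bigr => p _.
by rewrite /GRing.scale /= -mulrA [U _ * _]mulrC.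
Qed.

(** For factors without negative frequencies only finitely many products of
    coefficients contribute.  The factor [u] is replaced by its Fejer means,
    which are trigonometric polynomials and for which the formula is linear
    algebra; the Cesaro weights disappear in the limit. *)
Lemma fourier_coef_convolution (u v : C -> C) (U V : int -> C) (n : nat) (W : C) :
  @ucont R C^o u -> (exists B : C, forall l, `|l| = 1 -> `|v l| <= B) ->
  (forall k, fourier_coef u k (U k)) -> (forall k, fourier_coef v k (V k)) ->
  (forall k, k < 0 -> U k = 0) -> (forall k, k < 0 -> V k = 0) ->
  fourier_coef (fun l => u l * v l) n W ->
  W = \sum_(k < n.+1) U k%:Z * V (n%:Z - k%:Z).
Proof.
move=> uu [B vB] hU hV U0 V0 hW; set S := \sum_(k < n.+1) _.
pose G (k : int) := U k * V (n%:Z - k).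
(* T i is the i-th partial sum of the series of the G k, which is stationary
   from i = n on; the Cesaro sum of degree M is the average of T 0, ..., T M. *)
pose T (i : nat) := \sum_(k < i.+1) G k%:Z.
have TS i : (n <= i)%N -> T i = S.
  move=> ni; rewrite /T -(big_mkord xpredT (fun k => G k%:Z)) (big_cat_nat _ (n := n.+1))//=.
  rewrite big_mkord [X in _ + X]big1_seq ?addr0// => k; rewrite mem_index_iota => /andP[_ /andP[nk _]].
  by rewrite /G V0 ?mulr0// subr_lt0 ltz_nat.
have TG M i : (i <= M)%N -> \sum_(j < M.+1) G (i%:Z - j%:Z) = T i.
  move=> iM; rewrite /T -(big_mkord xpredT (fun j => G (i%:Z - j%:Z))).
  rewrite (big_cat_nat _ (n := i.+1))//= big_mkord [X in _ + X]big1_seq ?addr0; last first.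
    move=> k; rewrite mem_index_iota => /andP[_ /andP[nk _]].
    by rewrite /G U0 ?mul0r// subr_lt0 ltz_nat.
  rewrite (reindex_inj rev_ord_inj) /=; apply: eq_bigr => j _; congr G.
  by rewrite subSS -subzn ?opprB ?[_ + (_ - _)]addrC ?subrK// -ltnS.
have B0 : 0 <= B by apply: le_trans (vB 1 (normr1 _)).
have B1 : 0 < B + 1 by rewrite ltr_wpDl.
apply/eqP; rewrite -subr_eq0; apply/eqP; apply: (@norm_le_eps C^o) => e e0.
have e20 := divr_gt0 e0 (ltr0n C 2).
have e30 : 0 < e / 2 / (B + 1) by rewrite divr_gt0.
have [M0 hM0] := fejer_approx uu (divr_gt0 e30 (ltr0n C 2)).
pose c := \sum_(i < n) `|T i - S|.
have c0 : 0 <= c by apply: sumr_ge0.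
have [M1 hM1] := invS_mul_small e20 c0.
pose M := maxn n (maxn M0 M1).
have nM : (n <= M)%N by rewrite leq_maxl.
have M0M : (M0 <= M)%N by rewrite leq_max leq_maxl orbT.
have M1M : (M1 <= M)%N by rewrite leq_max leq_maxr orbT.
pose sigma l := M.+1%:R^-1 * \sum_(i < M.+1) \sum_(j < M.+1) U (i%:Z - j%:Z) * l ^ (i%:Z - j%:Z).
have su l : `|l| = 1 -> `|sigma l - u l| <= e / 2 / (B + 1).
  move=> l1; have [n0 hn0] := fejer_sum_limit M hU l1 (divr_gt0 e30 (ltr0n C 2)).
  have {}hn0 := hn0 (maxn n0 M) (leq_maxl _ _).
  have {}hM0 : `|fejer_mean (V := C^o) M (maxn n0 M) u l - u l| <= e / 2 / (B + 1) / 2.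
    by apply: hM0 => //; rewrite M0M leq_maxr.
  rewrite -(subrKA (fejer_mean (V := C^o) M (maxn n0 M) u l)) (splitr (e / 2 / (B + 1))).
  by rewrite (le_trans (ler_normD _ _))// lerD// distrC.
have hs : fourier_coef (fun l => sigma l * v l) n (M.+1%:R^-1 * \sum_(i < M.+1) T i).
  have -> : M.+1%:R^-1 * \sum_(i < M.+1) T i = \sum_(p : 'I_M.+1 * 'I_M.+1)
      (M.+1%:R^-1 * U (p.1%:Z - p.2%:Z)) *: (V (n%:Z - (p.1%:Z - p.2%:Z)) : C^o).
    rewrite -(pair_big xpredT xpredT (fun i j : 'I_M.+1 => (M.+1%:R^-1 * U (i%:Z - j%:Z)) *: (V (n%:Z - (i%:Z - j%:Z)) : C^o))) /=.
    rewrite mulr_sumr; apply: eq_bigr => i _; rewrite -(@TG M) -1?ltnS// mulr_sumr.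
    by apply: eq_bigr => j _; rewrite /G /GRing.scale /= mulrA.
  have ms := is_mean_sum (u := fun (p : 'I_M.+1 * 'I_M.+1) (l : C) => l ^ (- (n%:Z - (p.1%:Z - p.2%:Z))) * v l : C^o) _ _ (fun p : 'I_M.+1 * 'I_M.+1 => hV (n%:Z - (p.1%:Z - p.2%:Z))).
  apply: eq_is_mean (ms _ _) => l l1.
  rewrite /sigma pair_big /= -mulrA mulr_suml !mulr_sumr; apply: eq_bigr => -[i j] _ /=.
  have l0 := circle_neq0 l1.
  rewrite /GRing.scale /= (_ : - (n%:Z - (i%:Z - j%:Z)) = - n%:Z + (i%:Z - j%:Z)) ?opprB ?[_ + - n%:Z]addrC//.
  rewrite [l ^ (- n%:Z + _)]expfzDr//; ring.
have d1 : `|W - M.+1%:R^-1 * \sum_(i < M.+1) T i| <= e / 2.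
  have := is_meanZD (-1) hs hW; rewrite scaleN1r addrC => /(is_mean_le _); apply => l l1.
  rewrite scaleN1r addrC -mulrBr -mulrBl normrM norm_circleX// mul1r normrM distrC.
  apply: (@le_trans _ _ (e / 2 / (B + 1) * B)).
    by apply: ler_pM => //; [exact: su | exact: vB].
  by rewrite -mulrA ler_piMr ?(ltW e20)// mulrC ler_pdivrMr// mul1r ler_wpDr.
have d2 : `|M.+1%:R^-1 * \sum_(i < M.+1) T i - S| <= e / 2.
  have -> : M.+1%:R^-1 * \sum_(i < M.+1) T i - S = M.+1%:R^-1 * \sum_(i < M.+1) (T i - S).
    by rewrite sumrB sumr_const card_ord mulrBr -[X in _ = _ - _ * X]mulr_natl mulKf// pnatr_eq0.
  rewrite normrM ger0_norm ?invr_ge0//; apply: le_trans (hM1 _ M1M).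
  rewrite ler_wpM2l ?invr_ge0// (le_trans (ler_norm_sum _ _ _))//.
  rewrite -(big_mkord xpredT (fun i => `|T i - S|)) (big_cat_nat _ (n := n))//= ?(leqW nM)//.
  rewrite big_mkord [X in _ + X]big1_seq ?addr0// => k; rewrite mem_index_iota => /andP[_ /andP[nk _]].
  by rewrite TS// subrr normr0.
rewrite -(subrKA (M.+1%:R^-1 * \sum_(i < M.+1) T i)) (splitr e).
by rewrite (le_trans (ler_normD _ _))// lerD.
Qed.

End FourierCoefficients.

(** * Kernel functions and contractive rows of multipliers *)

Section RKHSBasics.
Variables (R : realType) (X : Type) (H : rkhs R X).
Local Notation C := (R[i] : numClosedFieldType).
Implicit Types f g h : hspace H.

Lemma ip_conj f g : (ip H f g)^* = ip H g f.
Proof. by rewrite [RHS](hermC (ip H)) expr0 mul1r. Qed.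

Lemma ip_suml (I : finType) (c : I -> C) (z : I -> hspace H) g :
  ip H (\sum_i c i *: z i) g = \sum_i c i * ip H (z i) g.
Proof. by rewrite linear_sumlz; apply: eq_bigr => i _; rewrite linearZl_LR. Qed.

Lemma ip_sumr (I : finType) (c : I -> C) (z : I -> hspace H) g :
  ip H g (\sum_i c i *: z i) = \sum_i (c i)^* * ip H g (z i).
Proof. by rewrite linear_sumr; apply: eq_bigr => i _; rewrite linearZr_LR. Qed.

Lemma ip_ge0 f : 0 <= ip H f f.
Proof. by rewrite -ip_norm exprn_ge0. Qed.

(** The arguments are exchanged because [ip] is linear in the first one, while
    the form in [psd] conjugates the coefficients of the first index. *)
Lemma psd_ip : psd (fun f g : hspace H => (ip H g f : C)).
Proof.
move=> I z c; have := ip_ge0 (\sum_i c i *: z i); congr (_ <= _).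
rewrite ip_sumr; apply: eq_bigr => i _; rewrite ip_suml mulr_sumr.
by apply: eq_bigr => j _; rewrite mulrA.
Qed.

Lemma ip_le f g : `|ip H f g| <= `|f| * `|g|.
Proof.
rewrite -(ler_pXn2r (ltn0Sn 1)) ?nnegrE ?mulr_ge0//.
by rewrite exprMn !ip_norm mulrC; exact: psd_CauchySchwarz psd_ip.
Qed.

Lemma ev_le f x : `|ev H f x| <= `|kvec H x| * `|f|.
Proof. by rewrite reproducing mulrC ip_le. Qed.

Lemma evZ (a : C) f x : ev H (a *: f) x = a * ev H f x.
Proof. by rewrite !reproducing linearZl_LR. Qed.

Lemma evD f g x : ev H (f + g) x = ev H f x + ev H g x.
Proof. by rewrite !reproducing linearDl. Qed.

Lemma rkernelE x y : rkernel H x y = ip H (kvec H y) (kvec H x).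
Proof. exact: reproducing. Qed.

Lemma psd_rkernel : psd (rkernel H : X -> X -> C).
Proof. by apply: eq_psd (psd_comp (kvec H) psd_ip) => x y; rewrite rkernelE. Qed.

Lemma rkernel_conj x y : (rkernel H x y)^* = rkernel H y x.
Proof. by rewrite !rkernelE ip_conj. Qed.

Lemma rkernel_diag x : rkernel H x x = `|kvec H x| ^+ 2.
Proof. by rewrite rkernelE ip_norm. Qed.

Lemma hnormE f : (hnorm f)%:C%C = `|f|.
Proof. by rewrite /hnorm RRe_real ?normr_real. Qed.

Lemma hnorm_ge0 f : 0 <= hnorm f.
Proof. by rewrite -ler0c hnormE normr_ge0. Qed.

Lemma hnorm_vecE r (F : 'I_r -> hspace H) :
  ((hnorm_vec F)%:C)%C ^+ 2 = \sum_i `|F i| ^+ 2.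
Proof.
rewrite -rmorphXn sqr_sqrtr ?sumr_ge0// => [|i _]; last by rewrite exprn_ge0 ?hnorm_ge0.
by rewrite rmorph_sum; apply: eq_bigr => i _; rewrite rmorphXn /= hnormE.
Qed.

(** The operator norm bounds tuples of norm at most 1, hence the rescaling; one
    row of the image has a smaller norm than the whole image. *)
Lemma contractive_row r (Phi : 'M[X -> R[i]]_r) (F : 'I_r -> hspace H) (i : 'I_r) :
  (forall i j, is_mult H (Phi i j)) -> (mx_mult_norm H Phi <= 1)%E ->
  exists2 g, (forall x, ev H g x = \sum_j Phi i j x * ev H (F j) x) &
    `|g| ^+ 2 <= \sum_j `|F j| ^+ 2.
Proof.
move=> mPhi cPhi; set s := hnorm_vec F.
have [s0|s0] := eqVneq s 0.
  have F0 j : F j = 0.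
    have := hnorm_vecE F; rewrite -/s s0 expr0n /= => /esym/eqP.
    rewrite psumr_eq0 => [/allP/(_ j)|k _]; last by rewrite exprn_ge0.
    by rewrite mem_index_enum sqrf_eq0 normr_eq0 => /(_ isT)/eqP.
  exists (0 : hspace H); last by rewrite normr0 expr0n sumr_ge0// => j _; rewrite exprn_ge0.
  by move=> x; rewrite linear0 big1// => j _; rewrite F0 linear0 mulr0.
have sp : 0 < s by rewrite lt_def s0 sqrtr_ge0.
pose sC : C := (s%:C)%C; have sC0 : 0 < sC by rewrite ltcR.
pose F' j := sC^-1 *: F j.
have F'1 : hnorm_vec F' = 1.
  apply/eqP; rewrite -(@pexpr_eq1 _ _ 2) ?sqrtr_ge0//; apply/eqP/complexI.
  rewrite rmorphXn hnorm_vecE.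
  under eq_bigr do rewrite normrZ exprMn.
  rewrite -mulr_sumr -hnorm_vecE -/s -/sC -exprMn gtr0_norm ?invr_gt0//.
  by rewrite mulVf ?expr1n// gt_eqF.
have [M hM] : exists M : 'I_r -> 'I_r -> hspace H, forall i j, ev H (M i j) = Phi i j \* ev H (F' j).
  have [M hM] := choice (fun p : 'I_r * 'I_r => mPhi p.1 p.2 (F' p.2)).
  by exists (fun i j => M (i, j)) => a b; rewrite hM.
pose G i := \sum_j M i j.
have hG a x : ev H (G a) x = \sum_j Phi a j x * ev H (F' j) x.
  rewrite /G linear_sum fct_sumE; apply: eq_bigr => j _; by rewrite hM.
have G1 : hnorm_vec G <= 1.
  rewrite -lee_fin; apply: le_trans cPhi; apply: ereal_sup_ubound.
  by exists G => //; exists F' => //; rewrite F'1.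
exists (sC *: G i).
  move=> x; rewrite evZ hG mulr_sumr; apply: eq_bigr => j _.
  by rewrite /F' evZ mulrCA mulVKf// gt_eqF.
rewrite normrZ exprMn gtr0_norm// -hnorm_vecE -/s -/sC ler_piMr ?exprn_ge0 ?(ltW sC0)//.
apply: (@le_trans _ _ (\sum_j `|G j| ^+ 2)).
  by rewrite (bigD1 i)//= lerDl sumr_ge0// => j _; rewrite exprn_ge0.
by rewrite -hnorm_vecE exprn_ile1 ?lecR ?sqrtr_ge0.
Qed.

End RKHSBasics.

(** * The McCullough-Quiggin inequality *)

Section McCulloughQuiggin.
Local Open Scope sesquilinear_scope.
Variables (R : realType) (X : Type) (H : rkhs R X).
Local Notation C := (R[i] : numClosedFieldType).
Implicit Types f g h : hspace H.
Local Notation K := (rkernel H : X -> X -> C).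

Lemma psdmx_mxblock n r (A : 'I_n -> 'I_n -> 'M[R[i]]_r) :
  (forall v : 'I_n -> 'cV[R[i]]_r, 0 <= \sum_i \sum_j ((v i)^t* *m A i j *m v j) 0 0) ->
  psdmx (\mxblock_(i < n, j < n) A i j).
Proof.
move=> h v; have := h (submxcol v); congr (_ <= _).
rewrite -[v in RHS]submxcolK.
have -> : (\mxcol_i submxcol v i)^t* = \mxrow_i (submxcol v i)^t* :> 'rV_(_).
  by rewrite tr_mxcol; apply/matrixP => i j; rewrite !mxE.
rewrite mul_mxrow_mxblock mul_mxrow_mxcol summxE exchange_big /=.
by apply: eq_bigr => j _; rewrite mulmx_suml summxE.
Qed.

(** A row of functions is interpolated by a square matrix whose other rows vanish:
    on the remaining coordinates the Pick matrix is that of the kernel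
    itself. *)
Lemma row_interpolation m (z : 'I_m.+1 -> X) (lam : 'I_m.+1 -> 'I_m.+1 -> C) :
  complete_NP H ->
  psd (fun i j => K (z i) (z j) * (1 - \sum_k lam i k * (lam j k)^*)) ->
  exists2 phi : 'I_m.+1 -> X -> C, (forall i k, phi k (z i) = lam i k) &
    forall F : 'I_m.+1 -> hspace H, exists2 g,
      (forall x, ev H g x = \sum_k phi k x * ev H (F k) x) & `|g| ^+ 2 <= \sum_k `|F k| ^+ 2.
Proof.
move=> cNP pl.
pose L i : 'M[R[i]]_m.+1 := \matrix_(a, b) if a == 0 then lam i b else 0.
have pL : psdmx (\mxblock_(i < m.+1, j < m.+1)
             (rkernel H (z i) (z j) *: (1%:M - L i *m (L j) ^t*))).
  apply: psdmx_mxblock => v.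
  have -> : \sum_i \sum_j ((v i)^t* *m (rkernel H (z i) (z j) *: (1%:M - L i *m (L j) ^t*)) *m v j) 0 0 =
     \sum_i \sum_j (v i 0 0)^* * v j 0 0 * (K (z i) (z j) * (1 - \sum_k lam i k * (lam j k)^*)) +
     \sum_(s < m) \sum_i \sum_j (v i (lift 0 s) 0)^* * (v j (lift 0 s) 0) * K (z i) (z j).
    rewrite [X in _ = _ + X]exchange_big /= -[RHS]big_split; apply: eq_bigr => i _ /=.
    rewrite [X in _ = _ + X]exchange_big /= -[RHS]big_split; apply: eq_bigr => j _ /=.
    rewrite -scalemxAr -scalemxAl mxE.
    have -> : ((v i)^t* *m (1%:M - L i *m (L j) ^t*) *m v j) 0 0 =
        \sum_s (v i s 0)^* * v j s 0 - (v i 0 0)^* * v j 0 0 * \sum_k lam i k * (lam j k)^*.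
      rewrite mulmxBr mulmx1 mulmxBl mxE [X in _ + X]mxE; congr (_ - _).
        by rewrite mxE; apply: eq_bigr => s _; rewrite !mxE.
      rewrite mulmxA -mulmxA mxE mulr_sumr; apply: eq_bigr => k _.
      have -> : ((v i)^t* *m L i) 0 k = (v i 0 0)^* * lam i k.
        rewrite mxE big_ord_recl big1 ?addr0 => [|s _]; rewrite !mxE//.
        by rewrite mulr0.
      have -> : ((L j)^t* *m v j) k 0 = (lam j k)^* * v j 0 0.
        rewrite mxE big_ord_recl big1 ?addr0 => [|s _]; rewrite !mxE//.
        by rewrite conjC0 mul0r.
      by ring.
    rewrite big_ord_recl -mulr_suml; ring.
  apply: addr_ge0; first exact: (pl _ id (fun i => v i 0 0)).
  by apply: sumr_ge0 => s _; exact: (@psd_rkernel R X H _ z (fun i => v i (lift 0 s) 0)).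
have [Phi [mPhi cPhi vPhi]] := cNP m.+1 m.+1 (ltn0Sn _) (ltn0Sn _) z L pL.
exists (fun k => Phi 0 k); last by move=> F; exact: contractive_row.
by move=> i k; have /matrixP/(_ 0 k) := vPhi i; rewrite !mxE.
Qed.

Lemma scalar_interpolation n (z : 'I_n -> X) (w : X -> C) (f : hspace H) :
  complete_NP H ->
  psd (fun x y => K x y * (1 - w x * (w y)^*)) ->
  exists2 g, (forall i, ev H g (z i) = w (z i) * ev H f (z i)) & `|g| <= `|f|.
Proof.
case: n z => [|n] z cNP pw; first by exists 0; [case | rewrite normr0].
pose lam i k : C := if (k : 'I_n.+1) == 0 then w (z i) else 0.
have [|phi pz pm] := @row_interpolation n z lam cNP.
  apply: eq_psd (psd_comp z pw) => i j; rewrite big_ord_recl big1 ?addr0// => k _.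
  by rewrite mul0r.
have [g hg ng] := pm (fun k => if k == 0 then f else 0).
exists g.
  move=> i; rewrite hg big_ord_recl big1 ?addr0 ?pz// => k _.
  by rewrite linear0 mulr0.
rewrite -(ler_pXn2r (ltn0Sn 1)) ?nnegrE//; apply: le_trans ng _.
by rewrite big_ord_recl big1 ?addr0// => k _; rewrite normr0 expr0n.
Qed.

(** Multiplication by the row [phi] maps tuples of functions vanishing at [p] to
    functions vanishing at [p].  On that subspace the kernel is
    K x y - K x p K p y / K p p, and contractivity of the row there is the
    positivity of this kernel times 1 - lam lam^*. *)
Lemma psd_interpolated_row m (z : 'I_m -> X) (p : X) (lam : 'I_m -> 'I_m -> C) (phi : 'I_m -> X -> C) :
  K p p != 0 ->
  (forall i k, phi k (z i) = lam i k) ->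
  (forall F : 'I_m -> hspace H, exists2 g,
      (forall x, ev H g x = \sum_k phi k x * ev H (F k) x) & `|g| ^+ 2 <= \sum_k `|F k| ^+ 2) ->
  psd (fun i j => (K (z i) (z j) - K (z i) p * K p (z j) / K p p) *
                  (1 - \sum_k lam i k * (lam j k)^*)).
Proof.
move=> Kp phiz phic.
(* h0 x is the projection of the kernel function at x onto the orthogonal
   complement of the kernel function at p. *)
pose h0 x := kvec H x - (K p x / K p p) *: kvec H p.
have h0p x : ip H (h0 x) (kvec H p) = 0.
  by rewrite /h0 linearBl linearZl_LR /= -!rkernelE mulfVK ?subrr.
have iph0 g x : ip H g (kvec H p) = 0 -> ip H g (h0 x) = ip H g (kvec H x).
  by move=> g0; rewrite /h0 linearBr linearZr_LR /= g0 mulr0 subr0.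
have K0 x y : ip H (h0 y) (h0 x) = K x y - K x p * K p y / K p p.
  rewrite iph0// /h0 linearBl linearZl_LR /= -!rkernelE; congr (_ - _).
  by rewrite mulrC mulrA.
apply: psd_of_form => c.
pose h := \sum_i c i *: h0 (z i).
(* g is the value at h of the adjoint of the compressed row operator. *)
pose g k := \sum_i (c i * (lam i k)^*) *: h0 (z i).
pose S := \sum_k `|g k| ^+ 2.
have gp k : ip H (g k) (kvec H p) = 0.
  by rewrite ip_suml big1// => i _; rewrite h0p mulr0.
have -> : \sum_i \sum_j (c i)^* * c j * ((K (z i) (z j) - K (z i) p * K p (z j) / K p p) *
                  (1 - \sum_k lam i k * (lam j k)^*)) = `|h| ^+ 2 - S.
  have -> : S = \sum_i \sum_j \sum_k (c i)^* * c j * ip H (h0 (z j)) (h0 (z i)) * (lam i k * (lam j k)^*).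
    rewrite /S [RHS]pair_big exchange_big /=; apply: eq_bigr => k _.
    rewrite -(pair_big xpredT xpredT (fun i j => (c i)^* * c j * ip H (h0 (z j)) (h0 (z i)) * (lam i k * (lam j k)^*))) /=.
    rewrite ip_norm ip_sumr; apply: eq_bigr => i _; rewrite ip_suml mulr_sumr.
    by apply: eq_bigr => j _; rewrite rmorphM /= conjCK; ring.
  rewrite ip_norm ip_sumr -sumrB; apply: eq_bigr => i _; rewrite ip_suml mulr_sumr -sumrB.
  by apply: eq_bigr => j _; rewrite -K0 -mulr_sumr; ring.
have [G hG nG] := phic g.
have Gp : ip H G (kvec H p) = 0.
  by rewrite -reproducing hG big1// => k _; rewrite reproducing gp mulr0.
have S0 : 0 <= S by apply: sumr_ge0 => k _; rewrite exprn_ge0.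
have SG : S = ip H G h.
  rewrite ip_sumr; under [RHS]eq_bigr => i _ do rewrite iph0// -reproducing hG mulr_sumr.
  rewrite exchange_big; apply: eq_bigr => k _ /=.
  rewrite ip_norm {2}/g ip_sumr; apply: eq_bigr => i _.
  by rewrite iph0// -reproducing phiz rmorphM /= conjCK mulrA.
rewrite subr_ge0; move: S0; rewrite le_eqVlt => /orP[/eqP <-|S0]; first by rewrite exprn_ge0.
have : S ^+ 2 <= S * `|h| ^+ 2.
  apply: (@le_trans _ _ ((`|G| * `|h|) ^+ 2)).
    by rewrite lerXn2r ?nnegrE ?(ltW S0) ?mulr_ge0// {1}SG -[leLHS]ger0_norm ?ip_le// -SG ltW.
  by rewrite exprMn ler_wpM2r// exprn_ge0.
by rewrite expr2 ler_pM2l.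
Qed.

(** Induction on the number of points.  Let q be one of the points.  The statement
    for the other points with base q provides row vectors lam with
    K x y (1 - lam x lam y^* ) = K x q K q y / K q q, a kernel of rank one.  These
    data satisfy the Pick condition, and interpolating them, in the form of
    [psd_interpolated_row] at the base p, leaves the claimed matrix times the
    same rank one kernel, which can be divided out. *)
Lemma McCullough_Quiggin m (z : 'I_m -> X) (p : X) : complete_NP H -> irreducible H ->
  psd (fun i j => 1 - K (z i) p * K p (z j) / (K (z i) (z j) * K p p)).
Proof.
move=> cNP [K0 _]; elim: m => [|m IH] in z p *.
  by apply: psd_of_form => c; rewrite big_ord0.
pose q := z ord0.
have pq : psd (fun i j => 1 - K (z i) q * K q (z j) / (K (z i) (z j) * K q q)).
  apply: psd_of_form => c.
  have qr x : 1 - K x q * K q q / (K x q * K q q) = 0.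
    by rewrite divff ?subrr// mulf_neq0// K0.
  have ql x : 1 - K q q * K q x / (K q x * K q q) = 0.
    by rewrite [K q q * _]mulrC divff ?subrr// mulf_neq0// K0.
  rewrite big_ord_recl big1 ?add0r => [|j _]; last by rewrite ql mulr0.
  under eq_bigr => i _ do rewrite big_ord_recl qr mulr0 add0r.
  exact: (IH (z \o lift ord0) q _ id (c \o lift ord0)).
have [B hB] := psd_gram pq.
have cq : (`|kvec H q| : C)^* = `|kvec H q| by rewrite geC0_conj.
pose lam i k := (B k i)^*.
have elam i j : 1 - \sum_k lam i k * (lam j k)^* = K (z i) q * K q (z j) / (K (z i) (z j) * K q q).
  under eq_bigr => k _ do rewrite conjCK.
  by rewrite -hB opprB addrC subrK.
have [|phi phiz phic] := @row_interpolation m z lam cNP.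
  apply: eq_psd (psd_rank1 (fun i => K (z i) q / `|kvec H q|)) => i j.
  rewrite elam rmorphM /= rkernel_conj fmorphV /= cq.
  have -> : K q q = `|kvec H q| ^+ 2 by rewrite rkernel_diag.
  have kq0 : `|kvec H q| != 0 by have := K0 q q; rewrite rkernel_diag sqrf_eq0.
  have := K0 (z i) (z j) => kij; field; by rewrite kq0 kij.
have := psd_conjmul (fun i => `|kvec H q| / K (z i) q) (psd_interpolated_row (K0 p p) phiz phic).
apply: eq_psd => i j; rewrite elam rmorphM /= fmorphV /= rkernel_conj cq.
have -> : K q q = `|kvec H q| ^+ 2 by rewrite rkernel_diag.
have kq0 : `|kvec H q| != 0 by have := K0 q q; rewrite rkernel_diag sqrf_eq0.
by field; rewrite kq0 !K0.
Qed.

End McCulloughQuiggin.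

(** * From positivity on finite sets to a multiplier *)

Section WeakCluster.
Variables (R : realType) (X : Type) (H : rkhs R X).
Local Notation C := (R[i] : numClosedFieldType).
Implicit Types f g h : hspace H.

Lemma hnorm_sqr f : (hnorm f ^+ 2)%:C%C = ip H f f :> C.
Proof. by rewrite rmorphXn /= hnormE ip_norm. Qed.

Lemma parallelogram f g :
  hnorm (f - g) ^+ 2 = 2 * hnorm f ^+ 2 + 2 * hnorm g ^+ 2 - 4 * hnorm (2^-1 *: (f + g)) ^+ 2.
Proof.
apply: (@complexI R); rewrite !mulr_natl rmorphB rmorphD !rmorphMn /= !hnorm_sqr.
rewrite -(ip_norm (_ *: _)) normrZ exprMn !ip_norm !(linearBl, linearDl, linearBr, linearDr) /=.
by rewrite ger0_norm ?invr_ge0//; field.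
Qed.

(** Weak compactness of bounded convex sets, by the parallelogram law: among the
    sets of the family the infimum of the norm has a supremum d, and the vectors
    of norm less than d + e in a set whose infimum exceeds d - e are close
    to each other, hence such almost minimal vectors form a Cauchy
    filter. *)
Lemma directed_cluster (A : set (set (hspace H))) (B : R) :
  A !=set0 ->
  (forall S, A S -> S !=set0) ->
  (forall S f g, A S -> S f -> S g -> S (2^-1 *: (f + g))) ->
  (forall S f, A S -> S f -> hnorm f <= B) ->
  (forall S T, A S -> A T -> exists2 U, A U & U `<=` S `&` T) ->
  exists g, forall S (e : C), A S -> 0 < e -> exists2 f, S f & `|f - g| <= e.
Proof.
move=> [S0 AS0] A0 Amid AB Adir.
pose n (S : set (hspace H)) := inf [set hnorm f | f in S].
pose D := [set n S | S in A]; pose d := sup D.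
have ninf S : A S -> has_inf [set hnorm f | f in S].
  move=> /A0[f Sf]; split; first by exists (hnorm f), f.
  by exists 0 => _ [g _ <-]; exact: hnorm_ge0.
have n_le S f : A S -> S f -> n S <= hnorm f.
  by move=> AS Sf; apply: ge_inf; [exact: (ninf _ AS).2 | exists f].
have n_ge0 S : A S -> 0 <= n S.
  by move=> AS; apply: lb_le_inf; [exact: (ninf _ AS).1 | move=> _ [g _ <-]; exact: hnorm_ge0].
have supD : has_sup D.
  split; first by exists (n S0), S0.
  exists B => _ [S AS <-]; have [f Sf] := A0 _ AS.
  exact: le_trans (n_le _ _ AS Sf) (AB _ _ AS Sf).
have n_d S : A S -> n S <= d by move=> AS; apply: (sup_upper_bound supD); exists S.
have d0 : 0 <= d by apply: le_trans (n_d _ AS0); exact: n_ge0.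
pose E (p : set (hspace H) * R) := p.1 `&` [set f | hnorm f < d + p.2].
pose F := filter_from [set p : set (hspace H) * R | A p.1 /\ 0 < p.2] E.
have PF : ProperFilter F.
  apply: filter_from_proper; last first.
    move=> [S e] [/= AS e0].
    have : inf [set hnorm f | f in S] < d + e by rewrite (le_lt_trans (n_d _ AS))// ltrDl.
    by move=> /(inf_lt (ninf _ AS).1)[_ [f Sf <-] fe]; exists f.
  apply: filter_from_filter; first by exists (S0, 1).
  move=> [S e] [T e'] [/= AS e0] [AT e'0]; have [U AU US] := Adir _ _ AS AT.
  exists (U, Num.min e e'); first by split => //=; rewrite lt_min e0.
  move=> f [/= /US[Sf Tf] fe]; split; split => //=; apply: lt_le_trans fe _.
    by rewrite lerD2l ge_min lexx.
  by rewrite lerD2l ge_min lexx orbT.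
have /cauchy_cvg cF : cauchy F.
  apply: cauchy_exP => e e0.
  have eR : e = (complex.Re e)%:C%C by rewrite RRe_real ?gtr0_real.
  have e'0 : 0 < complex.Re e by rewrite -ltcR -eR.
  set e' := complex.Re e in eR e'0.
  pose t := Num.min 1 (e' ^+ 2 / (2 * (4 * (4 * d + 1)))).
  have t0 : 0 < t.
    by rewrite lt_min ltr01 divr_gt0 ?exprn_gt0// !mulr_gt0// ltr_wpDl// mulr_ge0.
  have [_ [S AS <-] dS] := sup_adherent t0 supD; rewrite -/d in dS.
  have FS : F (E (S, t)) by exists (S, t).
  have [f fE] := filter_ex FS; exists f.
  apply: filterS FS => g gE; rewrite -ball_normE /=.
  rewrite -hnormE eR ltcR -(@ltr_pXn2r _ 2)// ?nnegrE ?hnorm_ge0 ?(ltW e'0)//.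
  rewrite parallelogram.
  have [fS ft] := fE; have [gS gt] := gE.
  have := n_le _ _ AS (Amid _ _ _ AS fS gS); set mid := hnorm (_ *: _) => hm.
  have f0 := hnorm_ge0 f; have g0 := hnorm_ge0 g; have S0' := n_ge0 _ AS.
  have t1 : t <= 1 by rewrite ge_min lexx.
  have t2 : t * (2 * (4 * (4 * d + 1))) <= e' ^+ 2.
    rewrite -ler_pdivlMr ?ge_min ?lexx ?orbT// !mulr_gt0// ltr_wpDl// mulr_ge0//.
  rewrite /= in ft gt.
  have e2 : 0 < e' ^+ 2 by rewrite exprn_gt0.
  have m2 : d ^+ 2 - 2 * d * t <= mid ^+ 2.
    have mdt : d - t <= mid by apply: le_trans hm; apply: ltW.
    have mid0 : 0 <= mid by apply: le_trans hm.
    have [td|dt] := leP t d.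
      have : 0 <= (mid - (d - t)) * (mid + (d - t)) by apply: mulr_ge0; rewrite ?(subr_ge0 (d - t))// addr_ge0// subr_ge0.
      have := sqr_ge0 t; rewrite -subr_sqr => ? ?; lra.
    have : 0 <= d * (2 * t - d) by rewrite mulr_ge0// subr_ge0; lra.
    have := sqr_ge0 mid; lra.
  have sq x : 0 <= x -> x < d + t -> x ^+ 2 <= d ^+ 2 + 2 * d * t + t.
    move=> x0 xdt; apply: (@le_trans _ _ ((d + t) ^+ 2)).
      by rewrite lerXn2r ?nnegrE ?(ltW xdt) ?addr_ge0 ?(ltW t0).
    have : t * t <= t by rewrite ler_piMr// ltW.
    lra.
  have f2 := sq _ f0 ft; have g2 := sq _ g0 gt.
  lra.
exists (lim F) => S e AS e0.
have FE : F (E (S, 1)) by exists (S, 1).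
have FB : F (ball (lim F) e) by apply: cF; exact: nbhsx_ballx.
have [f [[Sf _] fe]] := filter_ex (filterI FE FB).
by exists f => //; rewrite distrC ltW//; move: fe; rewrite -ball_normE.
Qed.

(** For each finite family of points the vectors of norm at most |h| that agree
    there with w h form a convex set, nonempty by interpolation; a cluster
    point of these sets agrees with w h everywhere. *)
Lemma contractive_multiplier (w : X -> C) h : complete_NP H ->
  psd (fun x y => (rkernel H x y : C) * (1 - w x * (w y)^*)) ->
  exists2 g, (forall x, ev H g x = w x * ev H h x) & `|g| <= `|h|.
Proof.
move=> cNP pw.
pose P (p : {n & 'I_n -> X}) := [set g : hspace H | `|g| <= `|h| /\
  forall i, ev H g (projT2 p i) = w (projT2 p i) * ev H h (projT2 p i)].
have [|||||g hg] := @directed_cluster (range P) (hnorm h).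
- by exists (P (existT _ 0%N (fun i : 'I_0 => match notF (ltn_ord i) with end))); eexists.
- move=> _ [[n z] _ <-]; have [g gz gh] := scalar_interpolation z h cNP pw.
  by exists g.
- move=> _ f g [[n z] _ <-] [fh fz] [gh gz]; split.
    rewrite normrZ ger0_norm ?invr_ge0// ler_pdivrMl// (le_trans (ler_normD _ _))//.
    by rewrite mulr_natl mulr2n lerD.
  by move=> i; rewrite evZ evD fz gz; field.
- by move=> _ f [p _ <-] [fh _]; rewrite -lecR !hnormE.
- move=> _ _ [[n z] _ <-] [[m y] _ <-].
  pose t (i : 'I_(n + m)) := match fintype.split i with inl a => z a | inr b => y b end.
  exists (P (existT _ (n + m)%N t)); first by eexists.
  move=> g [gh gt]; split; split => // i.
    have := gt (lshift m i); rewrite /= /t; case: splitP => j /= e.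
      by have -> : i = j by apply: val_inj.
    by have := ltn_ord i; rewrite e ltnNge leq_addr.
  have := gt (rshift n i); rewrite /= /t; case: splitP => j /= e.
    by have := ltn_ord j; rewrite -e ltnNge leq_addr.
  by have -> : i = j by apply: val_inj; apply: addnI e.
exists g.
  move=> x; apply/eqP; rewrite -subr_eq0; apply/eqP; apply: (@norm_le_eps R R[i]^o) => e e0.
  have e1 : 0 < e / (`|kvec H x| + 1) by rewrite divr_gt0// ltr_wpDl.
  have [|f [_ fx] fg] := hg (P (existT _ 1%N (fun=> x))) _ _ e1; first by eexists.
  have /= <- := fx ord0.
  have -> : ev H g x - ev H f x = ev H (g - f) x by rewrite !reproducing linearBl.
  rewrite (le_trans (ev_le _ _))// distrC.
  apply: (@le_trans _ _ (`|kvec H x| * (e / (`|kvec H x| + 1)))).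
    by rewrite ler_wpM2l.
  by rewrite mulrCA ler_piMr ?(ltW e0)// ler_pdivrMr ?ltr_wpDl// mul1r ler_wpDr.
rewrite -subr_ge0; apply: ge0_limit => e e0.
have [|f [fh _] fg] := hg (P (existT _ 0%N (fun i : 'I_0 => match notF (ltn_ord i) with end))) _ _ e0; first by eexists.
exists (`|h| - `|f|); first by rewrite subr_ge0.
have -> : `|h| - `|f| - (`|h| - `|g|) = `|g| - `|f| :> C by ring.
by rewrite (le_trans (ler_dist_dist _ _))// distrC.
Qed.

End WeakCluster.

(** * Fourier components of invariant kernels *)

Section GradedKernels.
Variables (R : realType) (X : Type) (T : circle_action R X).
Local Notation C := (R[i] : numClosedFieldType).

Definition invariant_kernel (L : X -> X -> C) :=
  forall l z w, `|l| = 1 -> L (act T l z) (act T l w) = L z w.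

(** A relation rather than a function, since the coefficient is only known to
    exist for kernels that are uniformly continuous along the orbits. *)
Definition kernel_fourier (L : X -> X -> C) (n : int) (Ln : X -> X -> C) :=
  forall z w, fourier_coef (fun l => L (act T l z) w) n (Ln z w).

Lemma act_mul (l m : C) z : `|l| = 1 -> `|m| = 1 -> act T (l * m) z = act T l (act T m z).
Proof. by move=> l1 m1; apply: actM. Qed.

Lemma fourier_coefZD u v k (a x y : C) : fourier_coef u k x -> fourier_coef v k y -> fourier_coef (fun l => a * u l + v l) k (a * x + y).
Proof.
move=> hu hv; apply: eq_is_mean (is_meanZD a hu hv) => l _.
by rewrite /GRing.scale /= mulrDr mulrCA.
Qed.

Lemma fourier_coefB u v k (x y : C) : fourier_coef u k x -> fourier_coef v k y -> fourier_coef (fun l => u l - v l) k (x - y).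
Proof.
move=> hu hv; have := fourier_coefZD (-1) hv hu; rewrite mulN1r addrC; apply: eq_is_mean => l _.
by rewrite mulN1r [- _ + _]addrC.
Qed.

Lemma fourier_coefZ u k (a x : C) : fourier_coef u k x -> fourier_coef (fun l => a * u l) k (a * x).
Proof.
move=> hu; have := fourier_coefZD (a - 1) hu hu; rewrite mulrBl mul1r subrK; apply: eq_is_mean => l _.
by rewrite mulrBl mul1r subrK.
Qed.

Lemma fourier_coef_homog (n k : int) (u : C -> C) (c : C) : (forall l, `|l| = 1 -> u l = l ^ n * c) ->
  fourier_coef u k ((n == k)%:R * c).
Proof.
move=> hu; have := fourier_coefZ c (fourier_coef_mono n k); rewrite mulrC; apply: eq_is_mean => l l1.
by rewrite hu// [l ^ n * c]mulrC.
Qed.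

Lemma fourier_coef_homog_eq (n : int) (u : C -> C) (c : C) :
  (forall l, `|l| = 1 -> u l = l ^ n * c) -> fourier_coef u n c.
Proof. by move/(fourier_coef_homog n); rewrite eqxx mul1r. Qed.

Lemma kernel_fourier_rot L n Ln m z w : kernel_fourier L n Ln -> `|m| = 1 -> Ln (act T m z) w = m ^ n * Ln z w.
Proof.
move=> h m1; apply: is_mean_unique (h (act T m z) w) _.
have := is_meanZD (m ^ n) (is_mean_rot m1 (h z w)) (@is_mean0 R R[i]^o).
rewrite addr0; apply: eq_is_mean => l l1; rewrite addr0 /GRing.scale /=.
have m0 := circle_neq0 m1; have l0 := circle_neq0 l1.
rewrite [m * l]mulrC act_mul// exprMz_comm ?unitfE//; last exact: mulrC.
by rewrite -mulrA mulrCA [m ^ n * _]mulrA -expfzDr// addrN expr0z mul1r.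
Qed.

Lemma kernel_fourier_invariant L n Ln : invariant_kernel L -> kernel_fourier L n Ln -> invariant_kernel Ln.
Proof.
move=> iL h l z w l1; apply: is_mean_unique (h _ _) _.
apply: eq_is_mean (h z w) => m m1.
by rewrite -[in RHS]act_mul// [m * l]mulrC act_mul// iL.
Qed.

(** Evaluate the form of L on the points z_i and on their translates by the N-th
    roots of unity.  With the coefficients l^n c_i / N on the translates alone,
    its limit is the form of Ln; subtracting these from the coefficients c_i
    on the points themselves, the limit is the form of L - 2 Ln + Ln. *)
Lemma psd_fourier_coef (L : X -> X -> C) n Ln : psd L -> invariant_kernel L -> kernel_fourier L n Ln ->
  psd Ln /\ psd (fun z w => L z w - Ln z w).
Proof.
move=> pL iL h.
pose Q (I : finType) (z : I -> X) (c : I -> C) (l : C) : R[i]^o :=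
  \sum_i \sum_j (c i)^* * c j * (l ^ (- n) * L (act T l (z i)) (z j)).
pose q (I : finType) (z : I -> X) (c : I -> C) : R[i]^o :=
  \sum_i \sum_j (c i)^* * c j * Ln (z i) (z j).
have hQ (I : finType) (z : I -> X) (c : I -> C) : is_mean (Q I z c) (q I z c).
  rewrite /Q /q.
  have ms i := @is_mean_sum R R[i]^o I (index_enum I) (fun j => (c i)^* * c j)
    (fun j l => l ^ (- n) * L (act T l (z i)) (z j)) (fun j => Ln (z i) (z j)) (fun j => h (z i) (z j)).
  have {}ms := is_mean_sum (index_enum I) (fun=> 1 : C) ms.
  have -> : \sum_i \sum_j (c i)^* * c j * Ln (z i) (z j) =
    \sum_i 1 *: \sum_j ((c i)^* * c j) *: (Ln (z i) (z j) : R[i]^o).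
    by apply: eq_bigr => i _; rewrite scale1r.
  apply: eq_is_mean ms => l _; apply: eq_bigr => i _; rewrite scale1r.
  by apply: eq_bigr => j _.
pose om N (p : 'I_N.+1) := omega R N ^+ p.
have om1 N p : `|om N p| = 1 by exact: norm_omegaX.
pose d (I : finType) (c : I -> C) N (p : I * 'I_N.+1) := N.+1%:R^-1 * c p.1 * om N p.2 ^ n.
pose y (I : finType) (z : I -> X) N (p : I * 'I_N.+1) := act T (om N p.2) (z p.1).
(* The contribution of pairs of translates, a double average over the circle,
   and the mixed contribution, a single average; both tend to the form of Ln. *)
pose T4 (I : finType) (z : I -> X) (c : I -> C) N :=
  \sum_p \sum_r (d I c N p)^* * d I c N r * L (y I z N p) (y I z N r).
pose T2 (I : finType) (z : I -> X) (c : I -> C) N :=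
  \sum_p \sum_j (d I c N p)^* * c j * L (y I z N p) (z j).
have conj_om N p : (om N p ^ n)^* = om N p ^ (- n).
  by rewrite -invr_expz; apply: circle_conjV; rewrite norm_circleX.
have sp (A B : finType) (F : A * B -> C) : \sum_p F p = \sum_b \sum_a F (a, b).
  by rewrite exchange_big pair_big; apply: eq_bigr => -[].
have T4E I z c N : T4 I z c N = avg (V := R[i]^o) N (fun m => avg (V := R[i]^o) N (fun l => Q I z c (m^-1 * l))).
  rewrite /T4 exchange_big sp /avg /GRing.scale /= mulr_sumr; apply: eq_bigr => m _.
  rewrite exchange_big sp mulrA mulr_sumr; apply: eq_bigr => l _.
  rewrite /Q mulr_sumr; apply: eq_bigr => i _; rewrite mulr_sumr; apply: eq_bigr => j _.
  have m1 := om1 N m; have l1 := om1 N l; have m0 := circle_neq0 m1; have l0 := circle_neq0 l1.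
  have mi1 : `|(om N m)^-1| = 1 by rewrite normfV m1 invr1.
  rewrite /d /y /= -/(om N m) -/(om N l).
  rewrite -[L (act T _ (z i)) (z j)](@iL (om N m))// -act_mul ?normrM ?mi1 ?l1 ?mulr1//.
  rewrite mulVKf// !rmorphM /= conj_om fmorphV rmorph_nat exprMz_comm ?unitfE ?invr_eq0//; last exact: mulrC.
  by rewrite exprz_inv opprK; ring.
have T2E I z c N : T2 I z c N = avg (V := R[i]^o) N (Q I z c).
  rewrite /T2 sp /avg /GRing.scale /= mulr_sumr; apply: eq_bigr => l _.
  rewrite /Q mulr_sumr; apply: eq_bigr => i _; rewrite mulr_sumr; apply: eq_bigr => j _.
  by rewrite /d /y /= -/(om N l) !rmorphM /= conj_om fmorphV rmorph_nat; ring.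
have T4q I z c e : 0 < e -> exists M, forall N, (M <= N)%N -> `|T4 I z c N - q I z c| <= e.
  move=> e0; have [M hM] := hQ I z c e e0; exists M => N MN; rewrite T4E.
  have -> : avg (V := R[i]^o) N (fun m => avg (V := R[i]^o) N (fun l => Q I z c (m^-1 * l))) - q I z c =
    avg (V := R[i]^o) N (fun m => avg (V := R[i]^o) N (fun l => Q I z c (m^-1 * l)) - q I z c).
    by rewrite avgB; congr (_ - _); rewrite /avg sumr_const card_ord -[X in _ *: X]scaler_nat scalerA mulVf ?scale1r// pnatr_eq0.
  by apply: norm_avg_le => m m1; apply: hM; rewrite // normfV m1 invr1.
have T2q I z c e : 0 < e -> exists M, forall N, (M <= N)%N -> `|T2 I z c N - q I z c| <= e.
  move=> e0; have [M hM] := hQ I z c e e0; exists M => N MN; rewrite T2E.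
  have := hM N 1 MN (normr1 _).
  by under [X in `|avg _ X - _|]eq_fun do rewrite mul1r.
have pLn : psd Ln.
  move=> I z c; apply: ge0_limit => e e0; have [M hM] := T4q I z c e e0.
  by exists (T4 I z c M); [exact: pL | exact: hM].
split => // I z c; apply: ge0_limit => e e0; have e30 : 0 < e / 3 by rewrite divr_gt0.
have [M1 hM1] := T4q I z c _ e30; have [M2 hM2] := T2q I z c _ e30.
pose N := maxn M1 M2; have {}hM1 := hM1 N (leq_maxl _ _); have {}hM2 := hM2 N (leq_maxr _ _).
pose q0 := \sum_i \sum_j (c i)^* * c j * L (z i) (z j).
exists (q0 - T2 I z c N - (T2 I z c N)^* + T4 I z c N).
  have := pL _ (fun s : I + (I * 'I_N.+1) => match s with inl i => z i | inr p => y I z N p end)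
     (fun s => match s with inl i => c i | inr p => - d I c N p end).
  congr (_ <= _); rewrite big_sumType /=.
  under eq_bigr do rewrite big_sumType /=.
  under [X in _ + X]eq_bigr do rewrite big_sumType /=.
  rewrite !big_split /= -/q0 !addrA; congr (_ + _); last first.
    by apply: eq_bigr => p _; apply: eq_bigr => r _; rewrite rmorphN mulrNN.
  rewrite addrAC; congr (_ + _).
    congr (_ + _); rewrite -sumrN; apply: eq_bigr => p _; rewrite -sumrN.
    by apply: eq_bigr => j _; rewrite rmorphN !mulNr.
  rewrite exchange_big rmorph_sum -sumrN; apply: eq_bigr => p _; rewrite rmorph_sum -sumrN.
  apply: eq_bigr => j _; rewrite !rmorphM /= !conjCK (psd_conj _ _ pL) /d; ring.
have qr : (q I z c)^* = q I z c by apply: geC0_conj; exact: pLn.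
have -> : \sum_i \sum_j (c i)^* * c j * (L (z i) (z j) - Ln (z i) (z j)) = q0 - q I z c.
  rewrite /q0 /q -sumrB; apply: eq_bigr => i _; rewrite -sumrB; apply: eq_bigr => j _.
  by rewrite mulrBr.
have -> : q0 - T2 I z c N - (T2 I z c N)^* + T4 I z c N - (q0 - q I z c) =
   - (T2 I z c N - q I z c) - (T2 I z c N - q I z c)^* + (T4 I z c N - q I z c).
  by rewrite rmorphB /= qr; ring.
rewrite (le_trans (ler_normD _ _))//.
have -> : e = e / 3 + e / 3 + e / 3 by field.
by rewrite lerD// (le_trans (ler_normB _ _))// lerD ?normrN ?norm_conjC.
Qed.


(** The components can be split off one at a time, since removing those of degree
    less than n does not change the one of degree n. *)
Lemma psd_Bessel (L : X -> X -> C) (Lc : int -> X -> X -> C) (n : nat) :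
  psd L -> invariant_kernel L -> (forall k, kernel_fourier L k (Lc k)) ->
  psd (fun z w => L z w - \sum_(k < n) Lc k%:Z z w).
Proof.
move=> pL iL hL; elim: n => [|n IH].
  by apply: eq_psd pL => z w; rewrite big_ord0 subr0.
pose M z w := L z w - \sum_(k < n) Lc k%:Z z w.
have iM : invariant_kernel M.
  move=> l z w l1; rewrite /M iL//; congr (_ - _); apply: eq_bigr => k _.
  exact: (kernel_fourier_invariant iL (hL k%:Z)).
have hM : kernel_fourier M n (Lc n).
  move=> z w; rewrite -[Lc n z w]subr0; apply: fourier_coefB => //; first exact: hL.
  have ms := @is_mean_sum R R[i]^o _ (index_enum 'I_n) (fun=> 1) (fun k l => l ^ (- n%:Z) * Lc k%:Z (act T l z) w)
     (fun=> 0).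
  have {}ms := ms _; rewrite big1 in ms => [|k _]; last by rewrite scaler0.
  apply: eq_is_mean (ms _) => [l _|k].
    by rewrite mulr_sumr; apply: eq_bigr => k _; rewrite scale1r.
  have := @fourier_coef_homog k n (fun l => Lc k (act T l z) w) (Lc k z w).
  have -> : (k%:Z == n%:Z) = false by apply/negbTE; rewrite eqz_nat ltn_eqF.
  rewrite mul0r; apply => l l1; exact: kernel_fourier_rot.
have [_ pM] := psd_fourier_coef IH iM hM.
by apply: eq_psd pM => z w; rewrite /M big_ord_recr /= opprD addrA.
Qed.

End GradedKernels.

(** * Homogeneous functions are multipliers *)

Section GradedSpace.
Variables (R : realType) (X : Type) (T : circle_action R X) (H : rkhs R X).
Local Notation C := (R[i] : numClosedFieldType).
Local Notation K := (rkernel H : X -> X -> C).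
Hypothesis sg : standard_graded T H.

Lemma K_invariant : invariant_kernel T K.
Proof. by move=> l z w l1; have [[_ h] _ _ _] := sg; apply: h. Qed.

Lemma K_cont z w (e : C) : 0 < e -> exists2 d : C, 0 < d &
  forall l, `|l| = 1 -> `|l - 1| < d -> `|K (act T l z) w - K z w| <= e.
Proof.
move=> e0; have [[h _] _ _ _] := sg.
have /subspace_continuousP/(_ 1 (normr1 _)) := h z w.
rewrite /from_subspace /= act1 => /cvgrPdist_le/(_ e e0) /nbhs_ballP[d /= d0 hd].
exists d => // l l1 ld; rewrite distrC; apply: hd => //.
by rewrite -ball_normE /= distrC.
Qed.

Lemma norm_kvec_act l w : `|l| = 1 -> `|kvec H (act T l w)| = `|kvec H w|.
Proof.
move=> l1; apply: (@pexpIrn _ 2); rewrite ?nnegrE//.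
by rewrite -!rkernel_diag K_invariant.
Qed.

(** The orbit map of a kernel function is as continuous as the scalar function
    K (l w) w is at l = 1, uniformly on the circle. *)
Lemma kvec_dist l m w : `|l| = 1 -> `|m| = 1 ->
  `|kvec H (act T l w) - kvec H (act T m w)| ^+ 2 =
    (K w w - K (act T (m^-1 * l) w) w) + (K w w - K (act T (m^-1 * l) w) w)^*.
Proof.
move=> l1 m1; have mi1 : `|m^-1| = 1 by rewrite normfV m1 invr1.
have <- : K (act T l w) (act T m w) = K (act T (m^-1 * l) w) w.
  rewrite -(K_invariant _ w m1) -act_mul ?mulVKf ?circle_neq0// normrM mi1 l1 mulr1//.
rewrite ip_norm !(linearBl, linearBr) /= -!rkernelE !K_invariant// rmorphB /= !rkernel_conj.
by ring.
Qed.

Lemma ucont_kvec w : ucont (fun l => kvec H (act T l w)).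
Proof.
split; first by exists `|kvec H w| => l l1; rewrite norm_kvec_act.
move=> e e0; have e20 : 0 < e ^+ 2 / 2 by rewrite divr_gt0 ?exprn_gt0.
have [d d0 hd] := K_cont w w e20; exists d => // l m l1 m1 lm.
have mi1 : `|m^-1| = 1 by rewrite normfV m1 invr1.
rewrite -(ler_pXn2r (ltn0Sn 1)) ?nnegrE ?(ltW e0)// -[leLHS]ger0_norm ?exprn_ge0//.
rewrite kvec_dist// (le_trans (ler_normD _ _))// norm_conjC distrC (splitr (e ^+ 2)).
have h : `|K (act T (m^-1 * l) w) w - K w w| <= e ^+ 2 / 2.
  apply: hd; first by rewrite normrM mi1 l1 mulr1.
  by rewrite -(mulVf (circle_neq0 m1)) -mulrBr normrM mi1 mul1r.
by rewrite lerD.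
Qed.

Lemma is_mean_ev (u : C -> hspace H) g z : is_mean u g ->
  @is_mean R R[i]^o (fun l => ev H (u l) z) (ev H g z).
Proof.
pose ev0 (h : hspace H) : R[i]^o := ev H h z.
have lin : linear ev0 by move=> a f h; rewrite /ev0 evD evZ.
pose ev1 : {linear hspace H -> R[i]^o} := HB.pack ev0 (GRing.isLinear.Build _ _ _ _ ev0 lin).
have B0 : 0 < `|kvec H z| + 1 by rewrite ltr_wpDl.
apply: (@is_mean_morph _ _ _ ev1 _ _ _ B0) => h.
by rewrite (le_trans (ev_le _ _))// ler_wpM2r// lerDl.
Qed.
(** The completeness of H is used in place of that of the scalars: the values
    are carried along the kernel function at x0, where evaluation at x0 reads
    them off. *)
Lemma scalar_mean_exists (u : C -> R[i]^o) : ucont u -> exists c, is_mean u c.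
Proof.
move=> uu; have [_ [x0 Kx0] _ _] := sg.
have [g hg] := mean_exists (ucontZ uu (ucont_cst (kvec H x0))).
exists (ev H g x0); apply: eq_is_mean (is_mean_ev x0 hg) => l _.
by rewrite evZ -/(rkernel H x0 x0) Kx0 mulr1.
Qed.

(** The vector g is the mean of l^-n times the kernel function at l^-1 w; it is
    the projection of the kernel function at w onto the homogeneous vectors
    of degree n. *)
Lemma K_component (n : int) (w : X) : exists2 g, homogeneous T n g &
  forall z, fourier_coef (fun l => K (act T l z) w) n (ev H g z).
Proof.
have [g hg] := mean_exists (ucontZ (ucontX R (- n)) (ucontV (ucont_kvec w))).
have gz z : fourier_coef (fun l => K (act T l z) w) n (ev H g z).
  apply: eq_is_mean (is_mean_ev z hg) => l l1; rewrite evZ; congr (_ * _).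
  rewrite -/(rkernel H z (act T l^-1 w)) -(K_invariant _ _ l1) -act_mul ?mulfV ?circle_neq0 ?act1//.
  by rewrite normfV l1 invr1.
exists g => // l z l1.
have := @kernel_fourier_rot _ _ T (fun z _ => K z w) n (fun z _ => ev H g z) l z w.
by apply.
Qed.

(** The grading enters here: the components of K of negative degree are kernel
    functions of the zero space, and that of degree 0 is constant in z, with the
    value 1 because K x0 w = 1. *)
Lemma K_coefs : exists Kc : int -> X -> X -> C,
  [/\ forall n, kernel_fourier T K n (Kc n), forall n z w, n < 0 -> Kc n z w = 0 & forall z w, Kc 0 z w = 1].
Proof.
have gex (p : int * X) : exists g, homogeneous T p.1 g /\
    forall z, fourier_coef (fun l => K (act T l z) p.2) p.1 (ev H g z).
  by have [g ? ?] := K_component p.1 p.2; exists g.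
have [g hg] := choice gex; have [_ [x0 Kx0] H0 Hneg] := sg.
exists (fun n z w => ev H (g (n, w)) z); split.
- by move=> n z w; exact: (hg (n, w)).2.
- move=> n z w n0; have := (hg (n, w)).1; rewrite /= Hneg// => ->.
  by rewrite linear0.
move=> z w; have [gh gc] := hg (0, w).
have : [set ev H f | f in homogeneous T 0] (ev H (g (0, w))) by exists (g (0, w)).
rewrite H0 => -[c _ gE].
rewrite -gE; have := gc x0; rewrite -gE /= => hc.
have h1 : fourier_coef (fun l => K (act T l x0) w) 0 1.
  apply: fourier_coef_homog_eq => l l1; rewrite expr0z mul1r.
  have -> : w = act T l (act T l^-1 w).
    by rewrite -act_mul ?mulfV ?act1 ?circle_neq0// normfV l1 invr1.
  by rewrite K_invariant// -rkernel_conj Kx0 conjC1.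
exact: is_mean_unique hc h1.
Qed.

(** A vector of norm at most 1 satisfies f f^* <= K as kernels.  For homogeneous
    f the kernel f f^* is invariant and is its own component of
    degree n. *)
Lemma psd_component_sub_homogeneous n f : homogeneous T n f -> `|f| <= 1 ->
  forall Kn, kernel_fourier T K n Kn -> psd (fun z w => Kn z w - ev H f z * (ev H f w)^*).
Proof.
move=> fn f1 Kn hK; pose L z w := K z w - ev H f z * (ev H f w)^*.
have pL : psd L.
  move=> I z c; pose h := \sum_i c i *: kvec H (z i).
  have -> : \sum_i \sum_j (c i)^* * c j * L (z i) (z j) = `|h| ^+ 2 - `|ip H f h| ^+ 2.
    rewrite ip_norm normCK ip_sumr /h ip_sumr rmorph_sum big_distrlr -sumrB /=.
    apply: eq_bigr => i _; rewrite ip_suml mulr_sumr -sumrB; apply: eq_bigr => j _.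
    by rewrite /L !reproducing -rkernelE rmorphM /= conjCK; ring.
  rewrite subr_ge0 lerXn2r ?nnegrE// (le_trans (ip_le _ _))//.
  by rewrite ler_piMl.
have iL : invariant_kernel T L.
  move=> l z w l1; rewrite /L K_invariant// !fn// rmorphM /= mulrACA circle_conjV ?norm_circleX//.
  by rewrite mulfV ?mul1r// circle_neq0// norm_circleX.
have hL : kernel_fourier T L n (fun z w => Kn z w - ev H f z * (ev H f w)^*).
  move=> z w; apply: fourier_coefB; first exact: hK.
  by apply: fourier_coef_homog_eq => l l1; rewrite fn// mulrA.
exact: (psd_fourier_coef pL iL hL).1.
Qed.

Hypotheses (irr : irreducible H) (cNP : complete_NP H).

(** The McCullough-Quiggin inequality at a base point where K is normalized. *)
Lemma psd_1subKV : psd (fun z w => 1 - (K z w)^-1).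
Proof.
have [_ [x0 Kx0] _ _] := sg; apply: psd_ord => m z c.
have := McCullough_Quiggin z x0 cNP irr id c; congr (_ <= _).
apply: eq_bigr => i _; apply: eq_bigr => j _.
rewrite -[K x0 (z j)]rkernel_conj !Kx0 conjC1 !mulr1 div1r//.
Qed.

Local Notation F := (fun z w => 1 - (K z w)^-1).

(** The diagonal values of F lie between 0 and 1, hence |F| <= 1. *)
Lemma Kinv_le2 z w : `|(K z w)^-1| <= 2.
Proof.
have F1 x : F x x <= 1.
  by rewrite lerBlDr lerDl invr_ge0; exact: psd_diag (psd_rkernel H).
have F0 x : 0 <= F x x by exact: psd_diag psd_1subKV.
have h : `|F z w| <= 1.
  rewrite -(ler_pXn2r (ltn0Sn 1)) ?nnegrE// expr1n.
  apply: le_trans (psd_CauchySchwarz z w psd_1subKV) _.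
  by rewrite mulr_ile1.
rewrite -[(K z w)^-1](subKr 1) (le_trans (ler_normB _ _))// normr1.
by rewrite [leRHS](_ : _ = 1 + 1)// lerD2l.
Qed.

Lemma ucont_K z w : ucont (fun l => K (act T l z) w : R[i]^o).
Proof.
apply: (@ucont_lipschitz R _ _ _ _ (`|kvec H w| * `|kvec H z|) `|kvec H w| (ucont_kvec z)) => //.
  by move=> l l1; rewrite rkernelE (le_trans (ip_le _ _))// norm_kvec_act.
by move=> l m l1 m1; rewrite !rkernelE -linearBr ip_le.
Qed.

Lemma ucont_F z w : ucont (fun l => F (act T l z) w : R[i]^o).
Proof.
have [K0 _] := irr.
apply: (@ucont_lipschitz R _ _ _ _ 3 4 (ucont_K z w)) => //.
  move=> l l1; rewrite (le_trans (ler_normB _ _))// normr1.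
  by rewrite [leRHS](_ : _ = 1 + 2) ?lerD2l ?Kinv_le2//; ring.
move=> l m l1 m1; set a := K _ w; set b := K _ w.
have -> : 1 - a^-1 - (1 - b^-1) = a^-1 * b^-1 * (a - b) by field; rewrite !K0.
rewrite !normrM ler_wpM2r// [leRHS](_ : _ = 2 * 2); last by ring.
by apply: ler_pM => //; exact: Kinv_le2.
Qed.

Lemma F_invariant : invariant_kernel T F.
Proof. by move=> l z w l1; rewrite K_invariant. Qed.

Lemma psd_K1 : psd (fun z w => K z w - 1).
Proof.
have [K0 _] := irr; apply: eq_psd (psdM psd_1subKV (psd_rkernel H)) => z w.
by rewrite mulrBl mul1r mulVf.
Qed.

(** The product F (K - 1) = K - 1 - F of positive kernels shows F <= K - 1, and
    the components of K - 1 of degree at most 0 vanish. *)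
Lemma F_coefs Kc : (forall n, kernel_fourier T K n (Kc n)) -> (forall n z w, n < 0 -> Kc n z w = 0) ->
  (forall z w, Kc 0 z w = 1) ->
  exists2 Fc, (forall n, kernel_fourier T F n (Fc n)) & forall n z w, n <= 0 -> Fc n z w = 0.
Proof.
move=> hK Kneg Kz.
have Fex (p : int * X * X) : exists c, fourier_coef (fun l => F (act T l p.1.2) p.2) p.1.1 c.
  exact: scalar_mean_exists (ucontZ (ucontX R (- p.1.1)) (ucont_F p.1.2 p.2)).
have [Fc hFc] := choice Fex; exists (fun n z w => Fc (n, z, w)).
  by move=> n z w; exact: hFc (n, z, w).
have hF n : kernel_fourier T F n (fun z w => Fc (n, z, w)) by move=> z w; exact: hFc (n, z, w).
move=> n z w n0.
have pM : psd (fun z w => K z w - 1 - F z w).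
  have [K0 _] := irr; apply: eq_psd (psdM psd_1subKV psd_K1) => x y.
  by field; rewrite K0.
have iM : invariant_kernel T (fun z w => K z w - 1 - F z w).
  by move=> l x y l1; rewrite !K_invariant.
have hM : kernel_fourier T (fun z w => K z w - 1 - F z w) n (fun z w => - Fc (n, z, w)).
  move=> x y; rewrite -[X in fourier_coef _ _ X]add0r; apply: fourier_coefB; last exact: hF.
  have -> : 0 = Kc n x y - (0 == n)%:R.
    by have [<-|nn] := eqVneq 0 n; rewrite ?Kz ?subrr// Kneg ?subr0// lt_neqAle eq_sym nn.
  apply: fourier_coefB; first exact: hK.
  rewrite -[(0 == n)%:R]mulr1; apply: fourier_coef_homog => l _.
  by rewrite expr0z mulr1.
apply: psd_antisym (psd_fourier_coef pM iM hM).1.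
exact: (psd_fourier_coef psd_1subKV F_invariant (hF n)).1.
Qed.

(** The induction on the degree by means of K = 1 + F K. *)
Lemma psd_mul_component Kc : (forall n, kernel_fourier T K n (Kc n)) ->
  (forall n z w, n < 0 -> Kc n z w = 0) -> (forall z w, Kc 0 z w = 1) ->
  forall n : nat, psd (fun z w => K z w * (1 - Kc n z w)).
Proof.
move=> hK Kneg Kz; have [K0 _] := irr.
have [Fc hF Fneg] := F_coefs hK Kneg Kz.
have rec (n : nat) z w : Kc n.+1 z w = \sum_(k < n.+1) Kc k z w * Fc (n.+1%:Z - k%:Z) z w.
  have -> : \sum_(k < n.+1) Kc k z w * Fc (n.+1%:Z - k%:Z) z w =
    \sum_(k < n.+2) Kc k z w * Fc (n.+1%:Z - k%:Z) z w.
    by rewrite [RHS]big_ord_recr /= subrr Fneg// mulr0 addr0.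
  apply: (@fourier_coef_convolution _ (fun l => K (act T l z) w) (fun l => F (act T l z) w)
    (fun k => Kc k z w) (fun k => Fc k z w)).
  - exact: ucont_K.
  - by have [] := ucont_F z w.
  - by move=> k; exact: hK.
  - by move=> k; exact: hF.
  - by move=> k; exact: Kneg.
  - by move=> k /ltW; exact: Fneg.
  have h1 : fourier_coef (fun=> 1) n.+1 (0 : C).
    have := @fourier_coef_homog R 0 n.+1 (fun=> 1) 1; rewrite mul0r; apply => l _.
    by rewrite expr0z mulr1.
  have := fourier_coefB (hK n.+1 z w) h1; rewrite subr0; apply: eq_is_mean => l _.
  by congr (_ * _); rewrite mulrBr mulr1 mulfV.
elim/ltn_ind => -[_|n IH].
  by apply: eq_psd (@psd0 C X) => z w; rewrite Kz subrr mulr0.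
have pF k : psd (Fc k) by exact: (psd_fourier_coef psd_1subKV F_invariant (hF k)).1.
have pB := psd_Bessel n.+2 psd_1subKV F_invariant hF.
have p1 : psd (fun _ _ : X => 1 : C).
  by apply: eq_psd (psd_rank1 (fun=> 1)) => x y; rewrite conjC1 mulr1.
have pS : psd (fun z w => \sum_(k < n.+1) Fc (n.+1%:Z - k%:Z) z w * (K z w * (1 - Kc k z w))).
  by apply: psd_sum => k _; apply: psdM => //; exact: IH.
apply: eq_psd (psdD (psdD p1 (psdM (psd_rkernel H) pB)) pS) => z w.
have -> : \sum_(k < n.+2) Fc k z w = \sum_(k < n.+1) Fc (n.+1%:Z - k%:Z) z w.
  rewrite big_ord_recl Fneg// add0r (reindex_inj rev_ord_inj); apply: eq_bigr => k _.
  have kn : (k <= n)%N by rewrite -ltnS.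
  have -> : (lift ord0 (rev_ord k))%:Z = n.+1%:Z - k%:Z.
    by rewrite lift0 /= subSS subzn ?(leqW kn)// subSn.
  by [].
rewrite rec.
have -> : \sum_(k < n.+1) Fc (n.+1%:Z - k%:Z) z w * (K z w * (1 - Kc k z w)) =
    K z w * (\sum_(k < n.+1) Fc (n.+1%:Z - k%:Z) z w -
             \sum_(k < n.+1) Kc k z w * Fc (n.+1%:Z - k%:Z) z w).
  by rewrite -sumrB mulr_sumr; apply: eq_bigr => k _; ring.
have Kzw := K0 z w; field; exact: Kzw.
Qed.

(** Rescaling to norm 1 reduces to the positivity of K (1 - f f^* ), which is the sum
    of K (1 - K_n) and K (K_n - f f^* ). *)
Theorem homogeneous_multiplier n f h : homogeneous T n f ->
  exists2 g, ev H g = ev H f \* ev H h & `|g| <= `|f| * `|h|.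
Proof.
move=> fn; have [f0|f0] := eqVneq f 0.
  exists 0; last by rewrite normr0 mulr_ge0.
  by rewrite f0 !linear0; apply/funext => x /=; rewrite mul0r.
have [Kc [hK Kneg Kz]] := K_coefs; have [_ _ _ Hneg] := sg.
case: n fn => n fn; last first.
  by move: fn; rewrite Hneg// => /eqP; rewrite (negbTE f0).
have nf0 : 0 < `|f| by rewrite normr_gt0.
have nfi : `|(`|f|^-1 : C)| = `|f|^-1 by rewrite ger0_norm ?invr_ge0.
pose f1 := `|f|^-1 *: f.
have f1n : homogeneous T n f1.
  by move=> l z l1; rewrite /f1 !evZ fn// mulrCA.
have nf1 : `|f1| <= 1 by rewrite normrZ nfi mulVf ?gt_eqF.
have pf : psd (fun z w => K z w * (1 - ev H f1 z * (ev H f1 w)^*)).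
  apply: eq_psd (psdD (psd_mul_component hK Kneg Kz n)
    (psdM (psd_rkernel H) (psd_component_sub_homogeneous f1n nf1 (hK n)))) => z w.
  by rewrite -mulrDr addrA subrK.
have [g hg ng] := contractive_multiplier h cNP pf.
exists (`|f| *: g); last by rewrite normrZ normr_id ler_wpM2l.
by apply/funext => x; rewrite evZ hg /f1 evZ mulrA mulrA mulfV ?mul1r// gt_eqF.
Qed.

End GradedSpace.

Theorem proposition6p4 (R : realType) (X : Type) (T : circle_action R X)
    (H : rkhs R X) (f : hspace H) (n : int) :
  irreducible H -> complete_NP H -> standard_graded T H ->
  homogeneous T n f ->
  is_mult H (ev H f) /\ mult_norm H (ev H f) = (hnorm f)%:E.
Proof.
move=> irr cNP sg fn.
have hm h := homogeneous_multiplier sg irr cNP h fn.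
split; first by move=> h; have [g hg _] := hm h; exists g.
apply/eqP; rewrite eq_le; apply/andP; split.
  apply: ge_ereal_sup => _ [g [h h1 gE] <-]; rewrite lee_fin.
  have [g' g'E ng'] := hm h; have -> : g = g' by apply: (@ev_inj _ _ H); rewrite gE.
  rewrite -lecR; apply: le_trans (_ : `|f| * `|h| <= _); first by rewrite hnormE.
  by rewrite hnormE ler_piMr// -hnormE lecR.
apply: ereal_sup_ubound; exists f => //.
have [_ [x0 Kx0] _ _] := sg; exists (kvec H x0).
  by rewrite -lecR hnormE -(@expr_le1 _ 2)// -rkernel_diag Kx0.
by apply/funext => x /=; rewrite -/(rkernel H x x0) Kx0 mulr1.
Qed.
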